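(* Let $X$ and $Y$ be $C^{\infty}$-manifolds and let $E$ be a complex $C^{\infty}$ vector bundle of rank $r$ on $X$. Let $$\varphi^{\sharp}: C^{\infty}(Y)\longrightarrow C^{\infty}(\mathrm{End}_{\mathbb C}(E))$$ be a map (of sets). Then the following three statements are equivalent: (1) $\varphi^{\sharp}$ is a ring-homomorphism over $\mathbb R\hookrightarrow\mathbb C$. (2) $\varphi^{\sharp}$ is a weakly $C^{\infty}$-admissible ring-homomorphism over $\mathbb R\hookrightarrow\mathbb C$. (3) $\varphi^{\sharp}$ is a $C^{\infty}$-admissible ring-homomorphism over $\mathbb R\hookrightarrow\mathbb C$.
   Context: Conventions. All manifolds are paracompact, Hausdorff, admit locally finite partitions of unity, and are embeddable into some $\mathbb R^N$ as closed submanifolds. $C^\infty(X)$ denotes the ring of real-valued smooth functions on $X$. $C^{\infty}(\mathrm{End}_{\mathbb C}(E))$ denotes the (in general noncommutative) $\mathbb C$-algebra of smooth sections of the endomorphism bundle $\mathrm{End}_{\mathbb C}(E)\to X$; it contains $C^\infty(X)$ as a subring via $h\mapsto h\cdot \mathrm{Id}_E$ (a subring of its center). Ring-homomorphism over $\mathbb R\hookrightarrow \mathbb C$: a unital ring-homomorphism from an $\mathbb R$-algebra to a $\mathbb C$-algebra that is compatible with the inclusion $\mathbb R\hookrightarrow\mathbb C$ of scalars, i.e. an $\mathbb R$-algebra homomorphism. $C^\infty$-ring: a set $R$ with an operation $\Phi_h:R^n\to R$ for every $n\ge 0$ and $h\in C^\infty(\mathbb R^n)$, such that coordinate functions $\mathbb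 R^n\to\mathbb R$ give the coordinate projections $R^n\to R$, and $\Phi_{g\circ(h_1,\dots,h_m)}=\Phi_g\circ(\Phi_{h_1},\dots,\Phi_{h_m})$ for all $g\in C^\infty(\mathbb R^m)$, $h_1,\dots,h_m\in C^\infty(\mathbb R^n)$. It has an underlying commutative $\mathbb R$-algebra structure. A $C^\infty$-ring homomorphism is a map commuting with all operations. For a manifold $M$, $C^\infty(M)$ is a $C^\infty$-ring via $\Phi_h(f_1,\dots,f_n)=h(f_1,\dots,f_n)$ (composition). A $C^\infty$-ring structure on an $\mathbb R$-algebra is required to be compatible with (i.e. to induce) the given $\mathbb R$-algebra structure. Weakly $C^\infty$-admissible: a ring-homomorphism $\varphi^\sharp:C^\infty(Y)\to C^\infty(\mathrm{End}_{\mathbb C}(E))$ over $\mathbb R\hookrightarrow\mathbb C$ is weakly $C^\infty$-admissible if the $\mathbb R$-subalgebra $\mathrm{Im}\,\varphi^\sharp$ admits a $C^\infty$-ring structure with respect to which $\varphi^\sharp:C^\infty(Y)\to \mathrm{Im}\,\varphi^\sharp$ is a $C^\infty$-ring homomorphism. $C^\infty$-admissible: let $pr_X:X\times Y\to X$ and $pr_Y:X\times Y\to Y$ be the projections, with pullbacks $pr_X^\sharp:C^\infty(X)\to C^\infty(X\times Y)$ and $pr_Y^\sharp:C^\infty(Y)\to C^\infty(X\times Y)$. A ring-homomorphism $\varphi^\sharp:C^\infty(Y)\to C^\infty(\mathrm{End}_{\mathbb C}(E))$ over $\mathbb R\hookrightarrow\mathbb C$ is $C^\infty$-admissible if there is a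 ring-homomorphism $\tilde\varphi^\sharp: C^\infty(X\times Y)\to C^\infty(\mathrm{End}_{\mathbb C}(E))$ over $\mathbb R\hookrightarrow\mathbb C$ with $\tilde\varphi^\sharp\circ pr_Y^\sharp=\varphi^\sharp$ and with $\tilde\varphi^\sharp\circ pr_X^\sharp$ equal to the inclusion $C^\infty(X)\hookrightarrow C^\infty(\mathrm{End}_{\mathbb C}(E))$, such that: (i) the $C^\infty$-ring structure of $C^\infty(X\times Y)$ descends via $\tilde\varphi^\sharp$ to a $C^\infty$-ring structure on the image $A_\varphi:=\mathrm{Im}(\tilde\varphi^\sharp)$; and (ii) with this $C^\infty$-ring structure on $A_\varphi$, the maps $\varphi^\sharp:C^\infty(Y)\to A_\varphi$, $C^\infty(X)\hookrightarrow A_\varphi$, $\tilde\varphi^\sharp:C^\infty(X\times Y)\to A_\varphi$, $pr_X^\sharp$ and $pr_Y^\sharp$ form a commutative diagram of $C^\infty$-ring homomorphisms. *)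

(* Defs.v *)
From HB Require Import structures.
From mathcomp Require Import all_boot all_order all_algebra.
From mathcomp Require Import complex.
From mathcomp Require Import all_classical all_reals.
From mathcomp Require Import topology normedtype landau derive.

Set Implicit Arguments.
Unset Strict Implicit.
Unset Printing Implicit Defensive.
Import Order.TTheory GRing.Theory Num.Theory.
Import numFieldNormedType.Exports.
Local Open Scope classical_set_scope.
Local Open Scope ring_scope.

Section Euclidean.
Variable R : realType.

(* k-fold Fréchet differentiability on U: f and all its iterated partial
   derivatives of order < k are differentiable at every point of U.  Only used
   for open U; the values of f outside U are then irrelevant. *)
Fixpoint ndiff_on n (k : nat) (U : set 'rV[R]_n) (f : 'rV[R]_n -> R) : Prop :=
  if k is k'.+1 then
    (forall x, U x -> differentiable f x) /\
    (forall i : 'I_n, ndiff_on k' U ('D_(delta_mx 0 i) f))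
  else True.

Definition smooth_on n (U : set 'rV[R]_n) (f : 'rV[R]_n -> R) : Prop :=
  forall k, ndiff_on k U f.

Lemma differentiable_near n (f g : 'rV[R]_n -> R) x :
  (\near x, f x = g x) -> differentiable f x -> differentiable g x.
Proof.
move=> fg df; have fgx : f x = g x by exact: nbhs_singleton fg.
have [cdf /eqaddoP dfo] := (diff_locallyP _ _).1 df.
have dgo : g \o shift x = cst (g x) + 'd f x +o_ (0 : 'rV[R]_n) id.
  apply/eqaddoP => e e0; have := dfo e e0.
  have : \forall y \near (0 : 'rV[R]_n), f (y + x) = g (y + x).
    by move: fg; rewrite (near_shift 0) /= subr0.
  by apply: filterS2 => y fgy; rewrite !fctE /= -fgx -fgy.
have dE := diff_unique cdf dgo.
by apply/diff_locallyP; rewrite dE.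
Qed.

Lemma ndiff_on_ext n k (U : set 'rV[R]_n) f g : open U ->
  (forall x, U x -> f x = g x) -> ndiff_on k U f -> ndiff_on k U g.
Proof.
move=> oU; elim: k f g => [//|k IHk] f g fg [df Df].
have fgn x : U x -> \near x, f x = g x.
  by move=> Ux; apply: filterS (open_nbhs_nbhs (conj oU Ux)) => y /fg.
split=> [x Ux|i]; first exact: differentiable_near (fgn x Ux) (df x Ux).
by apply: IHk (Df i) => x Ux; exact/near_eq_derive/fgn.
Qed.

Lemma ndiff_onS n k (U V : set 'rV[R]_n) f : U `<=` V ->
  ndiff_on k V f -> ndiff_on k U f.
Proof.
move=> UV; elim: k f => [//|k IHk] f [df Df]; split=> [x /UV/df//|i].
exact/IHk/Df.
Qed.

Lemma ndiff_onW n k (U : set 'rV[R]_n) f : ndiff_on k.+1 U f -> ndiff_on k U f.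
Proof.
elim: k f => [//|k IHk] f [df Df]; split=> // i; apply: IHk; exact: Df.
Qed.

Lemma ndiff_on_cst n k (U : set 'rV[R]_n) a : ndiff_on k U (cst a).
Proof.
elim: k a => [//|k IHk] a; split=> [x _|i]; first exact: differentiable_cst.
rewrite (_ : 'D_ _ _ = cst 0); first exact: IHk.
by apply/funext => x; exact: derive_cst.
Qed.

Lemma ndiff_onD n k (U : set 'rV[R]_n) f g : open U ->
  ndiff_on k U f -> ndiff_on k U g -> ndiff_on k U (f + g).
Proof.
move=> oU; elim: k f g => [//|k IHk] f g [df Df] [dg Dg].
split=> [x Ux|i]; first by apply: differentiableD; [exact: df|exact: dg].
apply: ndiff_on_ext (IHk _ _ (Df i) (Dg i)) => // x Ux.
by rewrite deriveD//; apply: diff_derivable; [exact: df|exact: dg].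
Qed.

Lemma ndiff_onM n k (U : set 'rV[R]_n) f g : open U ->
  ndiff_on k U f -> ndiff_on k U g -> ndiff_on k U (f * g).
Proof.
move=> oU; elim: k f g => [//|k IHk] f g fk gk.
have [[df Df] [dg Dg]] := (fk, gk).
split=> [x Ux|i]; first by apply: differentiableM; [exact: df|exact: dg].
have h := ndiff_onD oU (IHk _ _ (ndiff_onW fk) (Dg i)) (IHk _ _ (ndiff_onW gk) (Df i)).
apply: ndiff_on_ext h => // x Ux.
by rewrite deriveM//; apply: diff_derivable; [exact: df|exact: dg].
Qed.

Lemma ndiff_on_sum n k (U : set 'rV[R]_n) m (f : 'I_m -> 'rV[R]_n -> R) : open U ->
  (forall i, ndiff_on k U (f i)) -> ndiff_on k U (fun x => \sum_(i < m) f i x).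
Proof.
move=> oU fk; rewrite (_ : (fun _ => _) = \sum_(i < m) f i).
  elim/big_ind: _ => //; first exact: ndiff_on_cst.
  by move=> ? ?; exact: ndiff_onD.
by apply/funext => x; rewrite fct_sumE.
Qed.

Lemma differentiable_row n m (h : 'rV[R]_n -> 'rV[R]_m) x :
  (forall j, differentiable (fun p => h p 0 j) x) -> differentiable h x.
Proof.
move=> dh; rewrite (_ : h = \sum_(j < m) (fun p => h p 0 j *: delta_mx 0 j)).
  by apply: differentiable_sum => j; exact: differentiableZl.
by apply/funext => p; rewrite fct_sumE -row_sum_delta.
Qed.

Lemma derive_comp_row n m (g : 'rV[R]_m -> R) (h : 'rV[R]_n -> 'rV[R]_m) x v :
  differentiable h x -> differentiable g (h x) ->
  'D_v (g \o h) x =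
    \sum_(j < m) 'D_(delta_mx 0 j) g (h x) * 'D_v (fun p => h p 0 j) x.
Proof.
move=> dh dg; rewrite deriveE; last exact: differentiable_comp.
rewrite diff_comp//= -(deriveE v dh).
rewrite [in LHS](row_sum_delta ('D_v h x)) linear_sum; apply: eq_bigr => j _.
rewrite linearZ /= -deriveE// [LHS]mulrC; congr (_ * _).
have /diff_derivable -/(_ v) := dh => dv.
by rewrite derive_mx// mxE.
Qed.

Lemma ndiff_on_comp n m k (U : set 'rV[R]_n) (V : set 'rV[R]_m) g h :
  open U -> open V -> (forall x, U x -> V (h x)) ->
  ndiff_on k V g -> (forall j, ndiff_on k U (fun p => h p 0 j)) ->
  ndiff_on k U (g \o h).
Proof.
move=> oU oV UV; elim: k g => [//|k IHk] g [dg Dg] hk.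
have dh x : U x -> differentiable h x.
  by move=> Ux; apply: differentiable_row => j; have [+ _] := hk j; apply.
split=> [x Ux|i].
  by apply: differentiable_comp; [exact: dh|exact/dg/UV].
have H : ndiff_on k U (fun x => \sum_(j < m)
    (('D_(delta_mx 0 j) g \o h) * 'D_(delta_mx 0 i) (fun p => h p 0 j)) x).
  apply: ndiff_on_sum => // j; apply: ndiff_onM => //; last by have [_] := hk j; apply.
  by apply: IHk (Dg j) _ => l; exact/ndiff_onW/hk.
apply: ndiff_on_ext H => // x Ux.
by rewrite derive_comp_row//; [exact: dh|exact/dg/UV].
Qed.

Lemma ndiff_on_coord n k (U : set 'rV[R]_n) j : ndiff_on k U (fun p => p 0 j).
Proof.
case: k => [//|k]; split=> [x _|i]; first exact: differentiable_coord.
have -> : 'D_(delta_mx 0 i) (fun p : 'rV[R]_n => p 0 j) = (cst (i == j)%:R : 'rV[R]_n -> R);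
  last exact: ndiff_on_cst.
apply/funext => x.
have h : derivable (id : 'rV[R]_n -> 'rV[R]_n) x (delta_mx 0 i) by exact: derivable_id.
have := derive_mx h; rewrite derive_id => /matrixP/(_ 0 j).
by rewrite !mxE /= eq_sym => <-.
Qed.

Lemma smooth_on_ext n (U : set 'rV[R]_n) f g : open U ->
  (forall x, U x -> f x = g x) -> smooth_on U f -> smooth_on U g.
Proof. by move=> oU fg fs k; exact: ndiff_on_ext (fs k). Qed.

Lemma smooth_on_cst n (U : set 'rV[R]_n) a : smooth_on U (cst a).
Proof. by move=> k; exact: ndiff_on_cst. Qed.

Lemma smooth_onD n (U : set 'rV[R]_n) f g : open U ->
  smooth_on U f -> smooth_on U g -> smooth_on U (f + g).
Proof. by move=> oU fs gs k; exact: ndiff_onD. Qed.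

Lemma smooth_onM n (U : set 'rV[R]_n) f g : open U ->
  smooth_on U f -> smooth_on U g -> smooth_on U (f * g).
Proof. by move=> oU fs gs k; exact: ndiff_onM. Qed.

Lemma smooth_on_comp n m (U : set 'rV[R]_n) (V : set 'rV[R]_m) g h :
  open U -> open V -> (forall x, U x -> V (h x)) ->
  smooth_on V g -> (forall j, smooth_on U (fun p => h p 0 j)) ->
  smooth_on U (g \o h).
Proof.
by move=> oU oV UV gs hs k; apply: ndiff_on_comp (gs k) (fun j => hs j k).
Qed.

Lemma smooth_on_coord n (U : set 'rV[R]_n) j : smooth_on U (fun p => p 0 j).
Proof. by move=> k; exact: ndiff_on_coord. Qed.

End Euclidean.

Section Manifold.
Variable R : realType.

(* cinv is the inverse of cmap : cdom -> cmap @` cdom; its values outside this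
   image are irrelevant, as are those of cmap outside cdom. *)
Record chart (M : topologicalType) (n : nat) := Chart {
  cdom : set M;
  cmap : M -> 'rV[R]_n;
  cinv : 'rV[R]_n -> M;
  cdom_open : open cdom;
  cimg_open : open (cmap @` cdom);
  cmapK : {in cdom, cancel cmap cinv};
  cmap_continuous : {in cdom, continuous cmap};
  cinv_continuous : {in cmap @` cdom, continuous cinv} }.

(* A smooth manifold of dimension pdim before any separation or countability
   requirement.  The atlas need not be maximal. *)
Record premanifold := Premanifold {
  pcarrier :> topologicalType;
  pdim : nat;
  patlas : set (chart pcarrier pdim);
  patlas_cover : forall x, exists2 c, patlas c & cdom c x;
  patlas_compat : forall c d, patlas c -> patlas d -> forall j,
    smooth_on (cmap c @` (cdom c `&` cdom d))
              (fun p => cmap d (cinv c p) 0 j) }.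

(* Smoothness on W, meant for open W. *)
Definition msmooth_on (M : premanifold) (W : set M) (f : M -> R) : Prop :=
  forall c, patlas c -> smooth_on (cmap c @` (cdom c `&` W)) (f \o cinv c).

Definition msmooth (M : premanifold) (f : M -> R) : Prop := msmooth_on setT f.

Definition paracompact (T : topologicalType) : Prop :=
  forall O : set (set T), O `<=` open -> \bigcup_(U in O) U = setT ->
  exists P : set (set T), [/\ P `<=` open, \bigcup_(V in P) V = setT,
    forall V, P V -> exists2 U, O U & V `<=` U &
    forall x : T, exists2 W, nbhs x W &
      finite_set [set V | P V /\ V `&` W !=set0]].

Definition has_partitions_of_unity (M : premanifold) : Prop :=
  forall O : set (set M), O `<=` open -> \bigcup_(U in O) U = setT ->
  exists rho : set M -> M -> R, [/\
    forall U, O U -> msmooth (rho U) /\ (forall x, 0 <= rho U x),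
    forall U, O U -> closure [set x | rho U x != 0] `<=` U,
    forall x : M, exists2 W, nbhs x W &
      finite_set [set U | O U /\ [set y | rho U y != 0] `&` W !=set0] &
    forall x, \sum_(U \in O) rho U x = 1].

(* M is diffeomorphic to a closed submanifold of some R^N: a smooth injective
   immersion that is a closed map is a homeomorphism onto its closed image. *)
Definition has_closed_embedding (M : premanifold) : Prop :=
  exists (N : nat) (iota : M -> 'rV[R]_N), [/\
    forall j, msmooth (fun x => iota x 0 j),
    (forall c p v, patlas c -> (cmap c @` cdom c) p ->
      'd (iota \o cinv c) p v = 0 -> v = 0),
    injective iota &
    forall A : set M, closed A -> closed (iota @` A)].

(* The conditions are not independent (the last one implies the others); they
   are the standing conventions on manifolds, listed one by one. *)
Record manifold := Manifold {
  mpre :> premanifold;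
  m_hausdorff : hausdorff_space mpre;
  m_paracompact : paracompact mpre;
  m_partitions : has_partitions_of_unity mpre;
  m_embedding : has_closed_embedding mpre }.

Section ChartTheory.
Variables (M : topologicalType) (n : nat).
Implicit Types (c : chart M n) (W : set M).

Lemma cimgE c W : cmap c @` (cdom c `&` W) =
  (cmap c @` cdom c) `&` (cinv c @^-1` W).
Proof.
apply/seteqP; split => [p [x [cx Wx] <-]|p [[x cx <-]]].
  by split; [exists x|rewrite /preimage/= cmapK// inE].
by rewrite /preimage/= cmapK ?inE// => Wx; exists x.
Qed.

Lemma cimg_openI c W : open W -> open (cmap c @` (cdom c `&` W)).
Proof.
move=> oW; rewrite cimgE openE => p [cp Wp].
apply: filterI; first by apply: open_nbhs_nbhs; split=> //; exact: cimg_open.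
have nW : nbhs (cinv c p) W by exact: open_nbhs_nbhs.
exact: (@cinv_continuous _ _ c p (mem_set cp) W nW).
Qed.

End ChartTheory.

Lemma msmooth_on_ext (M : premanifold) (W : set M) f g : open W ->
  (forall x, W x -> f x = g x) -> msmooth_on W f -> msmooth_on W g.
Proof.
move=> oW fg fs c Ac; apply: smooth_on_ext (fs c Ac); first exact: cimg_openI.
by move=> p [x [cx Wx] <-] /=; rewrite cmapK ?inE//; exact: fg.
Qed.

Lemma msmooth_onS (M : premanifold) (W V : set M) f : W `<=` V ->
  msmooth_on V f -> msmooth_on W f.
Proof.
move=> WV fs c Ac k; move: (fs c Ac k); apply: ndiff_onS => _ [x [cx Wx] <-].
by exists x => //; split=> //; exact: WV.
Qed.

Section Closure.
Variables (M : premanifold) (W : set M).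
Hypothesis oW : open W.

Lemma msmooth_on_cst a : msmooth_on W (cst a).
Proof. by move=> c Ac; exact: smooth_on_cst. Qed.

Lemma msmooth_onD f g : msmooth_on W f -> msmooth_on W g -> msmooth_on W (f + g).
Proof.
by move=> fs gs c Ac; apply: (smooth_onD _ (fs c Ac) (gs c Ac)); exact: cimg_openI.
Qed.

Lemma msmooth_onM f g : msmooth_on W f -> msmooth_on W g -> msmooth_on W (f * g).
Proof.
by move=> fs gs c Ac; apply: (smooth_onM _ (fs c Ac) (gs c Ac)); exact: cimg_openI.
Qed.

Lemma msmooth_onN f : msmooth_on W f -> msmooth_on W (- f).
Proof.
move=> fs; rewrite (_ : - f = cst (-1) * f); first exact/msmooth_onM/fs/msmooth_on_cst.
by apply/funext => x; rewrite !fctE mulN1r.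
Qed.

End Closure.

End Manifold.

Section SmoothFunctions.
Variables (R : realType) (M : premanifold R).

Definition msmooth_pred : {pred M -> R} := [pred f | `[< msmooth f >]].

Record Cinf := MkCinf { cfun :> M -> R; cfun_subproof : cfun \in msmooth_pred }.

HB.instance Definition _ := [isSub for cfun].
HB.instance Definition _ := [Choice of Cinf by <:].

Lemma cfunP (f : Cinf) : msmooth f.
Proof. by have /asboolP := cfun_subproof f. Qed.

Lemma cinf_ext (f g : Cinf) : f =1 g -> f = g.
Proof. by move=> fg; apply/val_inj/funext. Qed.

Lemma msmooth_subring : subring_closed msmooth_pred.
Proof.
split=> [|f g /asboolP fs /asboolP gs|f g /asboolP fs /asboolP gs]; apply/asboolP.
- exact/msmooth_on_cst.
- exact/(msmooth_onD openT fs)/(msmooth_onN openT gs).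
- exact/(msmooth_onM openT fs).
Qed.

HB.instance Definition _ :=
  GRing.SubChoice_isSubComPzRing.Build (M -> R) msmooth_pred Cinf msmooth_subring.

Lemma msmooth_subsemimod : subsemimod_closed msmooth_pred.
Proof.
split=> [|a f /asboolP fs]; last first.
  apply/asboolP; rewrite (_ : a *: f = cst a * f); last exact/funext.
  exact/(msmooth_onM openT)/fs/msmooth_on_cst.
have [subr0 subrB _] := msmooth_subring.
split=> [|f g /asboolP fs /asboolP gs]; apply/asboolP.
- exact/msmooth_on_cst.
- exact/(msmooth_onD openT fs).
Qed.

HB.instance Definition _ :=
  GRing.SubZmodule_isSubLmodule.Build R (M -> R) msmooth_pred Cinf
    msmooth_subsemimod.

End SmoothFunctions.

Section EuclideanSpace.
Variables (R : realType) (n : nat).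

Program Definition euclid_chart : chart R 'rV[R]_n n :=
  @Chart R 'rV[R]_n n setT id id _ _ _ _ _.
Next Obligation. exact: openT. Qed.
Next Obligation. by rewrite image_id; exact: openT. Qed.
Next Obligation. by []. Qed.
Next Obligation. by move=> x _; exact: cvg_id. Qed.
Next Obligation. by move=> x _; exact: cvg_id. Qed.

Lemma euclid_cover (x : 'rV[R]_n) : exists2 c, [set euclid_chart] c & cdom c x.
Proof. by exists euclid_chart. Qed.

Lemma euclid_compat c d : [set euclid_chart] c -> [set euclid_chart] d ->
  forall j, smooth_on (cmap c @` (cdom c `&` cdom d))
                      (fun p => cmap d (cinv c p) 0 j).
Proof. by move=> -> -> j; exact: smooth_on_coord. Qed.

Definition euclid : premanifold R := Premanifold euclid_cover euclid_compat.

Lemma msmooth_euclid (f : euclid -> R) : smooth_on setT f -> msmooth f.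
Proof.
by move=> fs c -> k; exact: ndiff_onS (fs k).
Qed.

Lemma euclid_smooth (f : euclid -> R) : msmooth f -> smooth_on setT f.
Proof.
move=> /(_ euclid_chart erefl) fs k; apply: ndiff_onS (fs k) => p _.
by exists p.
Qed.

Lemma euclid_coord_smooth (i : 'I_n) :
  (fun p : euclid => p 0 i) \in msmooth_pred (M := euclid).
Proof. by apply/asboolP/msmooth_euclid; exact: smooth_on_coord. Qed.

Definition euclid_coord (i : 'I_n) : Cinf euclid := MkCinf (euclid_coord_smooth i).

End EuclideanSpace.

(* Phi_h(f_0, ..., f_(n-1)) = h(f_0, ..., f_(n-1)) on C^oo(M).  For M = R^m this
   is also the composition of a smooth function with n smooth functions. *)
Section Substitution.
Variables (R : realType) (M : premanifold R) (n : nat).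
Variables (h : Cinf (euclid R n)) (f : 'I_n -> Cinf M).

Lemma cinf_subst_smooth :
  (fun x : M => h (\row_(i < n) f i x)) \in msmooth_pred (M := M).
Proof.
apply/asboolP => c Ac.
have oc : open (cmap c @` (cdom c `&` setT)) by apply: cimg_openI; exact: openT.
apply: (@smooth_on_comp _ _ _ _ setT h (fun p => \row_(i < n) f i (cinv c p))) => //.
- exact: openT.
- exact/euclid_smooth/cfunP.
move=> j; apply: smooth_on_ext (cfunP (f j) Ac) => // p _.
by rewrite mxE.
Qed.

Definition cinf_subst : Cinf M := MkCinf cinf_subst_smooth.

End Substitution.

Section Product.
Variables (R : realType) (X Y : premanifold R).

Section ProductChart.
Variables (c : chart R X (pdim X)) (d : chart R Y (pdim Y)).

Let pmap (z : X * Y) : 'rV[R]_(pdim X + pdim Y) := row_mx (cmap c z.1) (cmap d z.2).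
Let pinv (p : 'rV[R]_(pdim X + pdim Y)) : X * Y :=
  (cinv c (lsubmx p), cinv d (rsubmx p)).

Lemma prod_imgE (A : set X) (B : set Y) : pmap @` (A `*` B) =
  (lsubmx @^-1` (cmap c @` A)) `&` (rsubmx @^-1` (cmap d @` B)).
Proof.
apply/seteqP; split => [_ [[x y] [/= Ax By] <-]|p [[x Ax xp] [y By yp]]].
  by split; rewrite /preimage /= ?row_mxKl ?row_mxKr; [exists x|exists y].
by exists (x, y) => //; rewrite /pmap /= xp yp hsubmxK.
Qed.

Lemma prod_img_open (A : set X) (B : set Y) :
  open (cmap c @` A) -> open (cmap d @` B) -> open (pmap @` (A `*` B)).
Proof.
move=> oA oB; rewrite prod_imgE; apply: openI; apply: open_comp => // p _.
- exact: continuous_lsubmx.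
- exact: continuous_rsubmx.
Qed.

Program Definition prod_chart : chart R (X * Y)%type (pdim X + pdim Y) :=
  @Chart R (X * Y)%type (pdim X + pdim Y) (cdom c `*` cdom d) pmap pinv _ _ _ _ _.
Next Obligation.
rewrite openE => -[x y] [/= cx dy]; exists (cdom c, cdom d) => //=.
by split; apply: open_nbhs_nbhs; split=> //; exact: cdom_open.
Qed.
Next Obligation. by apply: prod_img_open; exact: cimg_open. Qed.
Next Obligation.
move=> [x y]; rewrite inE => -[/= cx dy]; rewrite /pinv /pmap /= row_mxKl row_mxKr.
by rewrite !cmapK ?inE.
Qed.
Next Obligation.
move=> [x y]; rewrite inE => -[/= cx dy]; apply/cvg_ballP => e e0.
have hx : \forall z \near (x, y), ball (cmap c x) e (cmap c z.1).
  have /cvg_ballP/(_ e e0) := cmap_continuous (mem_set cx).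
  by move=> H; exact: (@cvg_fst _ _ (nbhs x) (nbhs y) _ _ H).
have hy : \forall z \near (x, y), ball (cmap d y) e (cmap d z.2).
  have /cvg_ballP/(_ e e0) := cmap_continuous (mem_set dy).
  by move=> H; exact: (@cvg_snd _ _ (nbhs x) (nbhs y) _ _ H).
apply: filterS2 hx hy => z [_ hx] [_ hy]; split=> // i j.
by rewrite !mxE; case: (fintype.split j) => k; [exact: hx|exact: hy].
Qed.
Next Obligation.
move=> p; rewrite inE prod_imgE => -[/= cp dp].
have hc : cinv c (lsubmx q) @[q --> p] --> cinv c (lsubmx p).
  apply: (@cvg_comp _ _ _ lsubmx (cinv c) _ (nbhs (lsubmx p))).
    exact: continuous_lsubmx.
  exact: (cinv_continuous (mem_set cp)).
have hd : cinv d (rsubmx q) @[q --> p] --> cinv d (rsubmx p).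
  apply: (@cvg_comp _ _ _ rsubmx (cinv d) _ (nbhs (rsubmx p))).
    exact: continuous_rsubmx.
  exact: (cinv_continuous (mem_set dp)).
exact: cvg_pair hc hd.
Qed.

End ProductChart.

Lemma smooth_on_lsubmx m n (U : set 'rV[R]_m) (V : set 'rV[R]_(m + n)) g :
  open U -> open V -> (forall p, V p -> U (lsubmx p)) ->
  smooth_on U g -> smooth_on V (fun p => g (lsubmx p)).
Proof.
move=> oU oV VU gs; apply: (@smooth_on_comp _ _ _ _ U g lsubmx) => // j.
apply: smooth_on_ext (@smooth_on_coord R _ V (lshift n j)) => // p _.
by rewrite mxE.
Qed.

Lemma smooth_on_rsubmx m n (U : set 'rV[R]_n) (V : set 'rV[R]_(m + n)) g :
  open U -> open V -> (forall p, V p -> U (rsubmx p)) ->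
  smooth_on U g -> smooth_on V (fun p => g (rsubmx p)).
Proof.
move=> oU oV VU gs; apply: (@smooth_on_comp _ _ _ _ U g rsubmx) => // j.
apply: smooth_on_ext (@smooth_on_coord R _ V (rshift m j)) => // p _.
by rewrite mxE.
Qed.

(* Only the smooth structure of X x Y is needed to form C^oo(X x Y). *)
Definition prod_atlas : set (chart R (X * Y)%type (pdim X + pdim Y)) :=
  [set prod_chart c d | c in @patlas R X & d in @patlas R Y].

Lemma prod_cover z : exists2 c, prod_atlas c & cdom c z.
Proof.
have [c Ac cx] := patlas_cover z.1; have [d Ad dy] := patlas_cover z.2.
by exists (prod_chart c d) => //; exists c => //; exists d.
Qed.

Lemma prod_compat c d : prod_atlas c -> prod_atlas d ->
  forall j, smooth_on (cmap c @` (cdom c `&` cdom d))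
                      (fun p => cmap d (cinv c p) 0 j).
Proof.
move=> [c1 Ac1 [d1 Ad1 <-]] [c2 Ac2 [d2 Ad2 <-]] j /=.
rewrite -setXI /=.
have oc : open (cmap c1 @` (cdom c1 `&` cdom c2)) by exact/cimg_openI/cdom_open.
have od : open (cmap d1 @` (cdom d1 `&` cdom d2)) by exact/cimg_openI/cdom_open.
have oV := prod_img_open oc od; rewrite -[j]splitK.
case: (fintype.split j) => k /=.
- have H := @smooth_on_lsubmx _ (pdim Y) _ _ _ oc oV _ (patlas_compat Ac1 Ac2 k).
  apply: smooth_on_ext (H _) => // [p _|p]; last by rewrite prod_imgE => -[].
  by rewrite row_mxEl.
- have H := @smooth_on_rsubmx (pdim X) _ _ _ _ od oV _ (patlas_compat Ad1 Ad2 k).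
  apply: smooth_on_ext (H _) => // [p _|p]; last by rewrite prod_imgE => -[].
  by rewrite row_mxEr.
Qed.

Definition prod_premanifold : premanifold R := Premanifold prod_cover prod_compat.

Lemma pr1_smooth (f : Cinf X) :
  (fun z : prod_premanifold => f z.1) \in msmooth_pred (M := prod_premanifold).
Proof.
apply/asboolP => _ [c Ac [d Ad <-]] /=; rewrite setIT.
have oV := prod_img_open (@cimg_open _ _ _ c) (@cimg_open _ _ _ d).
have H := @smooth_on_lsubmx _ (pdim Y) _ _ _ _ oV _ (cfunP f Ac).
rewrite setIT in H.
by apply: H; [exact: cimg_open|move=> p; rewrite prod_imgE => -[]].
Qed.

Lemma pr2_smooth (f : Cinf Y) :
  (fun z : prod_premanifold => f z.2) \in msmooth_pred (M := prod_premanifold).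
Proof.
apply/asboolP => _ [c Ac [d Ad <-]] /=; rewrite setIT.
have oV := prod_img_open (@cimg_open _ _ _ c) (@cimg_open _ _ _ d).
have H := @smooth_on_rsubmx (pdim X) _ _ _ _ _ oV _ (cfunP f Ad).
rewrite setIT in H.
by apply: H; [exact: cimg_open|move=> p; rewrite prod_imgE => -[]].
Qed.

Definition pr1_pullback (f : Cinf X) : Cinf prod_premanifold := MkCinf (pr1_smooth f).
Definition pr2_pullback (f : Cinf Y) : Cinf prod_premanifold := MkCinf (pr2_smooth f).

End Product.

Section Bundle.
Variables (R : realType) (X : premanifold R) (r : nat).
Local Notation C := R[i].

Definition csmooth_on (W : set X) (u : X -> C) : Prop :=
  msmooth_on W (fun x => complex.Re (u x)) /\
  msmooth_on W (fun x => complex.Im (u x)).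

(* A local trivialisation over bdom: a fibrewise linear isomorphism onto C^r;
   btriv c x is irrelevant for x outside bdom c. *)
Record bundle_chart (E : X -> vectType C) := BundleChart {
  bdom : set X;
  btriv : forall x, 'Hom(E x, 'cV[C]_r);
  bdom_open : open bdom;
  btriv_bij : forall x, bdom x -> bijective (btriv x) }.

(* A rank r complex vector bundle, given by its fibres and a vector bundle
   atlas with smooth transition functions g_dc(x) = btriv d x o (btriv c x)^-1.
   The topology and smooth structure of the total space are those for which
   the trivialisations are diffeomorphisms. *)
Record cvbundle := CVBundle {
  fiber :> X -> vectType C;
  batlas : set (bundle_chart fiber);
  batlas_cover : forall x, exists2 c, batlas c & bdom c x;
  batlas_compat : forall c d, batlas c -> batlas d -> forall i j,
    csmooth_on (bdom c `&` bdom d)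
      (fun x => btriv d x ((btriv c x)^-1%VF (delta_mx j 0)) i 0) }.

Lemma csmooth_on_ext W u v : open W ->
  (forall x, W x -> u x = v x) -> csmooth_on W u -> csmooth_on W v.
Proof.
move=> oW uv [uRe uIm]; split.
- by apply: msmooth_on_ext uRe => // x Wx; rewrite uv.
- by apply: msmooth_on_ext uIm => // x Wx; rewrite uv.
Qed.

Lemma csmooth_on_cst W (a : C) : csmooth_on W (cst a).
Proof. by split; exact: msmooth_on_cst. Qed.

Lemma csmooth_on_real W (f : X -> R) :
  msmooth_on W f -> csmooth_on W (fun x => (f x)%:C%C).
Proof. by move=> fs; split=> //=; exact: msmooth_on_cst. Qed.

Lemma csmooth_onD W u v : open W ->
  csmooth_on W u -> csmooth_on W v -> csmooth_on W (fun x => u x + v x).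
Proof.
move=> oW [uRe uIm] [vRe vIm]; split.
- apply: msmooth_on_ext (msmooth_onD oW uRe vRe) => // x _.
  by rewrite fctE; case: (u x) (v x) => ? ? [].
- apply: msmooth_on_ext (msmooth_onD oW uIm vIm) => // x _.
  by rewrite fctE; case: (u x) (v x) => ? ? [].
Qed.

Lemma csmooth_onM W u v : open W ->
  csmooth_on W u -> csmooth_on W v -> csmooth_on W (fun x => u x * v x).
Proof.
move=> oW [uRe uIm] [vRe vIm]; split.
- apply: msmooth_on_ext (msmooth_onD oW (msmooth_onM oW uRe vRe)
    (msmooth_onN oW (msmooth_onM oW uIm vIm))) => // x _.
  by rewrite !fctE; case: (u x) (v x) => ? ? [].
- apply: msmooth_on_ext (msmooth_onD oW (msmooth_onM oW uRe vIm)
    (msmooth_onM oW uIm vRe)) => // x _.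
  by rewrite !fctE; case: (u x) (v x) => ? ? [].
Qed.

Lemma csmooth_on_sum W m (u : 'I_m -> X -> C) : open W ->
  (forall k, csmooth_on W (u k)) -> csmooth_on W (fun x => \sum_(k < m) u k x).
Proof.
move=> oW us; rewrite (_ : (fun _ => _) = \sum_(k < m) u k).
  elim/big_ind: _ => //; first exact: (csmooth_on_cst W 0).
  by move=> ? ?; exact: csmooth_onD.
by apply/funext => x; rewrite fct_sumE.
Qed.

End Bundle.

Section EndomorphismSections.
Variables (R : realType) (X : premanifold R) (r : nat) (E : cvbundle X r).
Local Notation C := R[i].

(* The matrix of A in the trivialisation c. *)
Definition endmx (c : bundle_chart r E) (x : X) (A : 'End(E x)) : 'M[C]_r :=
  \matrix_(i, j) btriv c x (A ((btriv c x)^-1%VF (delta_mx j 0))) i 0.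

Definition end_smooth (s : forall x, 'End(E x)) : Prop :=
  forall c, batlas c -> forall i j,
    csmooth_on (bdom c) (fun x => endmx c (s x) i j).

Record endsec := EndSec {
  esec :> forall x, 'End(E x);
  esecP : end_smooth esec }.

Lemma endsec_ext (s t : endsec) : (forall x, s x = t x) -> s = t.
Proof.
case: s t => [s sP] [t tP] /= st.
have st' : s = t by apply: functional_extensionality_dep.
by rewrite {}st' in sP *; rewrite (Prop_irrelevance sP tP).
Qed.

Section EndMatrix.
Variables (c : bundle_chart r E) (x : X).
Implicit Types A B : 'End(E x).

Lemma endmxD A B : endmx c (A + B) = endmx c A + endmx c B.
Proof. by apply/matrixP => i j; rewrite !mxE add_lfunE linearD mxE. Qed.

Lemma endmxZ a A : endmx c (a *: A) = a *: endmx c A.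
Proof. by apply/matrixP => i j; rewrite !mxE scale_lfunE linearZ mxE. Qed.

Hypothesis cx : bdom c x.

Lemma btriv_ker : lker (btriv c x) == 0%VS.
Proof. by apply/lker0P/bij_inj/btriv_bij. Qed.

Lemma btriv_img : limg (btriv c x) = fullv.
Proof.
apply/vspaceP => v; rewrite memvf; have [g _ gK] := btriv_bij cx.
by rewrite -(gK v) memv_img// memvf.
Qed.

Lemma endmx1 : endmx c (\1%VF : 'End(E x)) = 1%:M.
Proof.
apply/matrixP => i j; rewrite !mxE id_lfunE limg_lfunVK ?btriv_img ?memvf//.
by rewrite mxE eqxx andbT.
Qed.

Lemma endmxM A B : endmx c (A \o B)%VF = endmx c A *m endmx c B.
Proof.
apply/matrixP => i j; rewrite !mxE comp_lfunE.
set w := B _; rewrite -[w in LHS](lker0_lfunK btriv_ker).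
have -> : btriv c x w = \sum_k btriv c x w k 0 *: delta_mx k 0.
  rewrite [LHS]matrix_sum_delta; apply: eq_bigr => k _; by rewrite big_ord1.
rewrite !linear_sum summxE; apply: eq_bigr => k _.
by rewrite !linearZ !mxE mulrC.
Qed.

End EndMatrix.

Lemma end_smooth0 : end_smooth (fun x => 0).
Proof.
move=> c Ac i j; apply: csmooth_on_ext (csmooth_on_cst (bdom c) 0).
- exact: bdom_open.
- by move=> x _; rewrite mxE zero_lfunE linear0 mxE.
Qed.

Lemma end_smoothD (s t : endsec) : end_smooth (fun x => s x + t x).
Proof.
move=> c Ac i j; apply: csmooth_on_ext
    (csmooth_onD (@bdom_open _ _ _ _ c) (esecP s Ac i j) (esecP t Ac i j)).
- exact: bdom_open.
- by move=> x _; rewrite endmxD [RHS]mxE.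
Qed.

Lemma end_smoothZ a (s : endsec) : end_smooth (fun x => a *: s x).
Proof.
move=> c Ac i j; apply: csmooth_on_ext (csmooth_onM (@bdom_open _ _ _ _ c)
    (csmooth_on_cst (bdom c) a) (esecP s Ac i j)).
- exact: bdom_open.
- by move=> x _; rewrite endmxZ [RHS]mxE.
Qed.

Lemma end_smoothM (s t : endsec) : end_smooth (fun x => (s x \o t x)%VF).
Proof.
move=> c Ac i j; have oc := @bdom_open _ _ _ _ c.
have H : csmooth_on (bdom c)
    (fun x => \sum_k endmx c (s x) i k * endmx c (t x) k j).
  by apply: csmooth_on_sum => // k; apply: csmooth_onM => //; exact: esecP.
by apply: csmooth_on_ext H => // x cx; rewrite endmxM// [RHS]mxE.
Qed.

Lemma scalar_end_smooth (f : Cinf X) :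
  end_smooth (fun x => (f x)%:C%C *: \1%VF).
Proof.
move=> c Ac i j; have oc := @bdom_open _ _ _ _ c.
have H : csmooth_on (bdom c) (fun x => (f x)%:C%C * (i == j)%:R).
  apply: csmooth_onM => //; last exact: csmooth_on_cst.
  by apply: csmooth_on_real; exact: msmooth_onS (cfunP f).
by apply: csmooth_on_ext H => // x cx; rewrite endmxZ endmx1// !mxE.
Qed.

(* The inclusion of C^oo(X) into the sections of End(E), f |-> f . Id_E. *)
Definition scalar_sec (f : Cinf X) : endsec := EndSec (scalar_end_smooth f).

Lemma end_smooth1 : end_smooth (fun x => \1%VF).
Proof.
move=> c Ac i j; have := scalar_end_smooth 1 Ac i j.
apply: csmooth_on_ext; first exact: bdom_open.
by move=> x _; rewrite scale1r.
Qed.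

Lemma end_smoothN (s : endsec) : end_smooth (fun x => - s x).
Proof.
move=> c Ac i j; have := end_smoothZ (-1) s Ac i j.
apply: csmooth_on_ext; first exact: bdom_open.
by move=> x _; rewrite scaleN1r.
Qed.

HB.instance Definition _ := gen_eqMixin endsec.
HB.instance Definition _ := gen_choiceMixin endsec.

Let add (s t : endsec) := EndSec (end_smoothD s t).
Let opp (s : endsec) := EndSec (end_smoothN s).
Let mul (s t : endsec) := EndSec (end_smoothM s t).
Let scale a (s : endsec) := EndSec (end_smoothZ a s).

Let addA : associative add.
Proof. by move=> s t u; apply: endsec_ext => x /=; rewrite addrA. Qed.
Let addC : commutative add.
Proof. by move=> s t; apply: endsec_ext => x /=; rewrite addrC. Qed.
Let add0 : left_id (EndSec end_smooth0) add.
Proof. by move=> s; apply: endsec_ext => x /=; rewrite add0r. Qed.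
Let addN : left_inverse (EndSec end_smooth0) opp add.
Proof. by move=> s; apply: endsec_ext => x /=; rewrite addNr. Qed.

HB.instance Definition _ := GRing.isZmodule.Build endsec addA addC add0 addN.

Let mulA : associative mul.
Proof. by move=> s t u; apply: endsec_ext => x /=; rewrite comp_lfunA. Qed.
Let mul1 : left_id (EndSec end_smooth1) mul.
Proof. by move=> s; apply: endsec_ext => x /=; rewrite comp_lfun1l. Qed.
Let mulr1 : right_id (EndSec end_smooth1) mul.
Proof. by move=> s; apply: endsec_ext => x /=; rewrite comp_lfun1r. Qed.
Let mulDl : left_distributive mul +%R.
Proof. by move=> s t u; apply: endsec_ext => x /=; rewrite comp_lfunDl. Qed.
Let mulDr : right_distributive mul +%R.
Proof. by move=> s t u; apply: endsec_ext => x /=; rewrite comp_lfunDr. Qed.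

HB.instance Definition _ :=
  GRing.Zmodule_isPzRing.Build endsec mulA mul1 mulr1 mulDl mulDr.

Let scaleA a b s : scale a (scale b s) = scale (a * b) s.
Proof. by apply: endsec_ext => x /=; rewrite scalerA. Qed.
Let scale1 : left_id 1 scale.
Proof. by move=> s; apply: endsec_ext => x /=; rewrite scale1r. Qed.
Let scaleDr : right_distributive scale +%R.
Proof. by move=> a s t; apply: endsec_ext => x /=; rewrite scalerDr. Qed.
Let scaleDl s : {morph scale^~ s : a b / a + b}.
Proof. by move=> a b; apply: endsec_ext => x /=; rewrite scalerDl. Qed.

HB.instance Definition _ :=
  GRing.Zmodule_isLmodule.Build C endsec scaleA scale1 scaleDr scaleDl.

End EndomorphismSections.

Section CinfRings.
Variable R : realType.

Record cinf_ring (A : Type) := CinfRing {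
  cop : forall n, Cinf (euclid R n) -> ('I_n -> A) -> A;
  cop_coord : forall n (i : 'I_n) (a : 'I_n -> A), cop (euclid_coord R i) a = a i;
  cop_subst : forall m n (g : Cinf (euclid R m)) (h : 'I_m -> Cinf (euclid R n))
    (a : 'I_n -> A),
    cop (cinf_subst g h) a = cop g (fun j => cop (h j) a) }.

Definition cinf_hom (A B : Type) (SA : cinf_ring A) (SB : cinf_ring B)
    (f : A -> B) : Prop :=
  forall n (h : Cinf (euclid R n)) (a : 'I_n -> A),
    f (cop SA h a) = cop SB h (f \o a).

(* f takes its values in I, and f : A -> I is a C^oo-ring homomorphism. *)
Definition cinf_hom_into (A B : Type) (SA : cinf_ring A) (I : set B)
    (SI : cinf_ring I) (f : A -> B) : Prop :=
  exists2 f' : A -> I, (forall a, val (f' a) = f a) & cinf_hom SA SI f'.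

Lemma cinf_substE (M : premanifold R) n (i : 'I_n) (a : 'I_n -> Cinf M) :
  cinf_subst (euclid_coord R i) a = a i.
Proof. by apply: cinf_ext => x /=; rewrite mxE. Qed.

Lemma cinf_substA (M : premanifold R) m n (g : Cinf (euclid R m))
    (h : 'I_m -> Cinf (euclid R n)) (a : 'I_n -> Cinf M) :
  cinf_subst (cinf_subst g h) a = cinf_subst g (fun j => cinf_subst (h j) a).
Proof. by apply: cinf_ext. Qed.

Definition Cinf_ring (M : premanifold R) : cinf_ring (Cinf M) :=
  CinfRing (@cinf_substE M) (@cinf_substA M).

End CinfRings.

Section Admissibility.
Variables (R : realType) (X : premanifold R) (r : nat) (E : cvbundle X r).

(* Unital ring homomorphisms compatible with the scalars R -> C. *)
Definition ring_hom_over (M : premanifold R) (phi : Cinf M -> endsec E) : Prop :=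
  [/\ zmod_morphism phi, monoid_morphism phi &
      forall (a : R) (f : Cinf M), phi (a *: f) = a%:C%C *: phi f].

(* The R-algebra structure induced by S (addition and multiplication are the
   operations of x_0 + x_1 and x_0 x_1, scaling by a that of a x_0, and the unit
   is the operation of the constant 1 on R^0) is the one of I as a subset of the
   algebra of sections of End(E). *)
Definition cinf_compatible (I : set (endsec E)) (S : cinf_ring R I) : Prop :=
  [/\ forall v : 'I_2 -> I,
        val (cop S (euclid_coord R ord0 + euclid_coord R ord_max) v) =
        val (v ord0) + val (v ord_max),
      forall v : 'I_2 -> I,
        val (cop S (euclid_coord R ord0 * euclid_coord R ord_max) v) =
        val (v ord0) * val (v ord_max),
      forall (a : R) (v : 'I_1 -> I),
        val (cop S (a *: euclid_coord R ord0) v) = a%:C%C *: val (v ord0) &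
      forall v : 'I_0 -> I, val (cop S 1 v) = 1].

Variable Y : premanifold R.
Variable phi : Cinf Y -> endsec E.

Definition weakly_Cinf_admissible : Prop :=
  exists S : cinf_ring R (range phi),
    cinf_compatible S /\ cinf_hom_into (Cinf_ring Y) S phi.

(* That the C^oo-ring structure of C^oo(X x Y) descends to the image of phit
   means that S makes the surjection phit a homomorphism, which determines S. *)
Definition Cinf_admissible : Prop :=
  exists phit : Cinf (prod_premanifold X Y) -> endsec E,
    [/\ ring_hom_over phit,
        forall f : Cinf Y, phit (pr2_pullback X f) = phi f,
        forall f : Cinf X, phit (pr1_pullback Y f) = scalar_sec E f &
        exists S : cinf_ring R (range phit),
          [/\ cinf_compatible S,
              cinf_hom_into (Cinf_ring (prod_premanifold X Y)) S phit,
              cinf_hom_into (Cinf_ring Y) S phi,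
              cinf_hom_into (Cinf_ring X) S (scalar_sec E) &
              cinf_hom (Cinf_ring X) (Cinf_ring (prod_premanifold X Y))
                (@pr1_pullback R X Y) /\
              cinf_hom (Cinf_ring Y) (Cinf_ring (prod_premanifold X Y))
                (@pr2_pullback R X Y)]].

End Admissibility.

(* Main.v *)
(* The content is the smoothness of x |-> phi(F(x, .))(x) for F smooth on X x Y;
   this section is the value at F of the extension of phi to C^oo(X x Y).  In
   local trivialisations phi is a family Phi_p of algebra homomorphisms from
   C^oo(Y) to real matrices.  Hadamard's lemma F_p = F_q + sum_i (p_i - q_i) Q_i
   reduces the continuity of p |-> Phi_p(F_p) to its local boundedness for all F,
   and then shows that its derivative is made of Phi_p(dF_p) and of an entry of
   the block homomorphism [[Phi, dPhi], [0, Phi]], so that an induction over all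
   homomorphisms gives smoothness.  For the local boundedness, the eigenvalues of
   Phi_p(w) are values of w, hence real and bounded, and Newton interpolation at
   these eigenvalues in each coordinate w_j writes Phi_p(F_p) with bounded
   coefficients, the remainders being killed by Cayley-Hamilton.
   Hadamard's lemma also shows that the kernel of a homomorphism is compatible
   with all C^oo-operations, so that these descend to its image. *)
Require Import Defs.
From HB Require Import structures.
From mathcomp Require Import all_boot all_order all_algebra.
From mathcomp Require Import perm complex.
From mathcomp Require Import all_classical all_reals.
From mathcomp Require Import topology normedtype landau derive realfun measure.
From mathcomp Require Import lebesgue_measure lebesgue_integral ftc.
From mathcomp Require Import ring lra.

Set Implicit Arguments.
Unset Strict Implicit.
Unset Printing Implicit Defensive.
Import Order.TTheory GRing.Theory Num.Theory.
Import numFieldNormedType.Exports.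
Local Open Scope classical_set_scope.
Local Open Scope ring_scope.

(** * Calculus *)

(** Each [phi f] is smooth by definition, but [phi] carries no continuity in [f], so nothing
    controls Phi_p(F_p) at the outset when homomorphism and argument vary together. The algebra laws
    of the extension hold point by point of X; only smoothness resists. The bound has to be uniform
    in p although the eigenvalues of Phi_p(w) may collide and are not followed continuously.
    Newton's form suits this: Hadamard quotients replace divided differences, so that no difference
    of eigenvalues is ever a denominator and the nodes only have to be bounded. The interpolated
    functions must be smooth on a whole R^q and take bounded, globally defined functions on Y as
    arguments: bump functions cut off the charts of Y, and a cube of parameters is reparametrised by
    all of R^n. As Y need not be compact, local bounds can be added up only after a proper function,
    the squared norm of a closed embedding, has shown that Phi_p ignores everything outside one
    compact set for p near p0. *)

Lemma cvg_sum_fin (R : numFieldType) (V : normedModType R) (T : Type)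
    (F : set_system T) (I : finType) (f : I -> T -> V) (l : I -> V) : Filter F ->
  (forall i, f i x @[x --> F] --> l i) -> \sum_i f i x @[x --> F] --> \sum_i l i.
Proof. by move=> FF fl; apply: cvg_big => //; exact: add_continuous. Qed.

Lemma cvg_prod_fin (R : numFieldType) (T : Type) (F : set_system T)
    (I : finType) (f : I -> T -> R) (l : I -> R) : Filter F ->
  (forall i, f i x @[x --> F] --> l i) -> \prod_i f i x @[x --> F] --> \prod_i l i.
Proof. by move=> FF fl; apply: cvg_big => //; exact: mul_continuous. Qed.

(** * Integrals over the unit interval *)

Section UnitIntegral.
Variable R : realType.
Implicit Types f g : R -> R.

Definition int01 g : R := \int[lebesgue_measure]_(t in `[0, 1]) g t.

Definition cont01 g : Prop := forall t, t \in `[0, 1] -> {for t, continuous g}.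

Lemma cont01_integrable g : cont01 g ->
  lebesgue_measure.-integrable `[0, 1] (EFin \o g).
Proof.
move=> cg; apply: continuous_compact_integrable; first exact: segment_compact.
by apply: continuous_in_subspaceT => t; rewrite inE => t01; exact: cg.
Qed.

Lemma eq_int01 f g : (forall t, t \in `[0, 1] -> f t = g t) -> int01 f = int01 g.
Proof. by move=> fg; apply: eq_Rintegral => t; rewrite inE; exact: fg. Qed.

Lemma int01_cst a : int01 (fun=> a) = a.
Proof.
by rewrite /int01 Rintegral_cst//= lebesgue_measure_itv/= lte_fin ltr01 oppr0 adde0 mulr1.
Qed.

Lemma int01D f g : cont01 f -> cont01 g ->
  int01 (fun t => f t + g t) = int01 f + int01 g.
Proof. by move=> cf cg; apply: RintegralD => //; exact: cont01_integrable. Qed.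

Lemma int01B f g : cont01 f -> cont01 g ->
  int01 (fun t => f t - g t) = int01 f - int01 g.
Proof. by move=> cf cg; apply: RintegralB => //; exact: cont01_integrable. Qed.

Lemma int01Z a g : cont01 g -> int01 (fun t => a * g t) = a * int01 g.
Proof. by move=> cg; apply: RintegralZl => //; exact: cont01_integrable. Qed.

Lemma cont01_sum n (f : 'I_n -> R -> R) : (forall i, cont01 (f i)) ->
  cont01 (fun t => \sum_i f i t).
Proof.
by move=> cf t t01; apply: cvg_sum_fin => i; exact: cf.
Qed.

Lemma int01_sum n (f : 'I_n -> R -> R) : (forall i, cont01 (f i)) ->
  int01 (fun t => \sum_i f i t) = \sum_i int01 (f i).
Proof.
elim: n f => [|n IHn] f cf.
  rewrite big_ord0 -[RHS]int01_cst; apply: eq_int01 => t _; exact: big_ord0.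
rewrite big_ord_recl -IHn// -int01D//; last exact: cont01_sum.
by apply: eq_int01 => t _; exact: big_ord_recl.
Qed.

Lemma int01_bound g e : cont01 g -> (forall t, t \in `[0, 1] -> `|g t| <= e) ->
  `|int01 g| <= e.
Proof.
move=> cg ge; apply: le_trans (le_normr_Rintegral _ (cont01_integrable cg)) _ => //.
rewrite -[leRHS]int01_cst; apply: le_Rintegral => //.
- by apply: cont01_integrable => t t01; apply: cvg_norm; exact: cg.
- by apply: cont01_integrable => t t01; exact: cvg_cst.
Qed.

(** Compactness of [0, 1] makes the joint continuity at the points (t, z0) uniform in t: for z near
    z0 the integrands differ by at most e everywhere, hence so do the integrals. *)
Lemma int01_continuous (T : topologicalType) (g : R -> T -> R) (O : set T) :
  open O ->
  (forall t z, t \in `[0, 1] -> O z ->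
    {for (t, z), continuous (fun q : R * T => g q.1 q.2)}) ->
  forall z, O z -> {for z, continuous (fun z => int01 (g^~ z))}.
Proof.
move=> oO cg z0 Oz0.
have cg1 z : O z -> cont01 (g^~ z).
  move=> Oz t t01.
  apply: (@continuous_comp _ _ _ (fun t : R => (t, z)) (fun q : R * T => g q.1 q.2)).
    have hs : s @[s --> t] --> t by exact: cvg_id.
    have hz : z @[s --> t] --> z by exact: cvg_cst.
    exact: cvg_pair hs hz.
  exact: cg.
apply/cvgrPdist_le => e e0.
have /compact_near_coveringP/near_covering_withinP cov := @segment_compact R 0 1.
have H : \forall z \near z0, `[0, 1] `<=` [set t | `|g t z0 - g t z| <= e].
  apply: cov => t t01.
  have /cvgrPdist_le/(_ (e / 2)) := cg t z0 t01 Oz0.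
  rewrite divr_gt0// => /(_ isT) [[A B] /= [At Bz] AB].
  exists (A, B) => //= -[s z] [/= As Bz'] _.
  have := AB (s, z) (conj As Bz').
  have := AB (s, z0) (conj As (nbhs_singleton Bz)).
  rewrite /= => h1 h2; rewrite [leLHS](_ : _ = `|(g t z0 - g s z) - (g t z0 - g s z0)|).
    by rewrite (splitr e); apply: le_trans (ler_normB _ _) _; exact: lerD.
  by congr (`|_|); rewrite opprB [RHS]addrC addrA subrK.
have On : \forall z \near z0, O z by exact: open_nbhs_nbhs.
apply: filterS2 H On => z gz Oz; rewrite -int01B; [|exact: cg1..].
apply: int01_bound => [t t01|t t01]; last exact: gz.
by apply: cvgB; exact: cg1.
Qed.

Lemma int01_derive (F f : R -> R) : cont01 f ->
  (forall t : R, t \in `[0, 1] -> is_derive (t : R) (1 : R) F (f t)) -> int01 f = F 1 - F 0.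
Proof.
move=> cf dF; rewrite /int01 /Rintegral (@continuous_FTC2 _ f F)//.
- by apply: continuous_in_subspaceT => t; rewrite inE => t01; exact: cf.
- have cF t : t \in `[0, 1] -> {for t, continuous F}.
    move=> t01; apply: differentiable_continuous; apply/derivable1_diffP.
    by have [] := dF t t01.
  split=> [t t01||].
  + by have [] := dF t (subset_itv_oo_cc t01).
  + by apply: cvg_at_right_filter; apply: cF; rewrite in_itv/= lexx ler01.
  + by apply: cvg_at_left_filter; apply: cF; rewrite in_itv/= lexx ler01.
- move=> t t01; rewrite derive1E.
  by have /@derive_val := dF t (subset_itv_oo_cc t01).
Qed.

End UnitIntegral.

(** * Differentiability from an expansion with continuous coefficients *)

Section Caratheodory.
Variable R : realType.

Lemma coord_le_norm n (v : 'rV[R]_n) i : `|v 0 i| <= `|v|.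
Proof.
rewrite [`|v|]mx_normrE.
by rewrite (le_trans _ (le_bigmax _ (fun ij => `|v ij.1 ij.2|) (0, i))).
Qed.

(** Freezing [u i z] at [u i z0] costs o(|z - z0|) by mere continuity at z0. The coefficients need
    not be differentiable, which lets integrals, and later values of homomorphisms, play their
    part. *)
Lemma caratheodory_diff n (f : 'rV[R]_n -> R) (u : 'I_n -> 'rV[R]_n -> R)
    (z0 : 'rV[R]_n) :
  (\forall z \near z0, f z = f z0 + \sum_i (z 0 i - z0 0 i) * u i z) ->
  (forall i, {for z0, continuous (u i)}) ->
  differentiable f z0 /\ forall i, 'D_(delta_mx 0 i) f z0 = u i z0.
Proof.
move=> fE cu.
pose l (v : 'rV[R]_n) := \sum_i v 0 i * u i z0.
have lin : linear l.
  move=> a v w; rewrite /l scaler_sumr -big_split/=; apply: eq_bigr => i _.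
  by rewrite !mxE mulrDl scalerAl.
pose L : {linear 'rV[R]_n -> R} :=
  HB.pack l (GRing.isLinear.Build R 'rV[R]_n R *:%R l lin).
have cL : continuous L.
  move=> v; have Fv := nbhs_filter v; apply: (cvg_sum_fin Fv) => i; apply: cvgM; last exact: cvg_cst.
  exact: (@coord_continuous R 1 n 0 i v).
have dfo : f \o shift z0 = (cst (f z0) + L) +o_ (0 : 'rV[R]_n) id.
  apply/eqaddoP => e e0.
  (* Each of the n summands will be at most |v| e / (n + 1); the successor keeps the quotient
     meaningful for n = 0. *)
  have e1 : 0 < e / n.+1%:R by rewrite divr_gt0.
  have H : \forall z \near z0, forall i, `|u i z0 - u i z| <= e / n.+1%:R.
    apply: (@filter_forall _ _ (fun i z => `|u i z0 - u i z| <= e / n.+1%:R) (nbhs z0)).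
    by move=> i; have /cvgrPdist_le/(_ _ e1) := cu i.
  have : \forall v \near (0 : 'rV[R]_n), f (v + z0) = f z0 + \sum_i v 0 i * u i (v + z0)
     /\ forall i, `|u i z0 - u i (v + z0)| <= e / n.+1%:R.
    have : \forall z \near z0, f z = f z0 + \sum_i (z 0 i - z0 0 i) * u i z /\
        forall i, `|u i z0 - u i z| <= e / n.+1%:R by apply: filterS2 fE H.
    rewrite (near_shift 0) /= subr0.
    apply: filterS => v [E ?]; split=> //; move: E; rewrite /= => ->.
    by congr (_ + _); apply: eq_bigr => i _; rewrite mxE addrK.
  apply: filterS => v [E uv]; rewrite !fctE /= E opprD addrACA subrr add0r /L/= /l.
  rewrite -sumrB; apply: le_trans (ler_norm_sum _ _ _) _.
  have le1 : \sum_(i < n) `|v 0 i * u i (v + z0) - v 0 i * u i z0| <=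
     \sum_(i < n) `|v| * (e / n.+1%:R).
    apply: ler_sum => i _; rewrite -mulrBr normrM distrC.
    by apply: ler_pM => //; exact: coord_le_norm.
  apply: le_trans le1 _; rewrite sumr_const card_ord -(mulr_natr (_ * _)) -mulrA mulrC.
  apply: ler_wpM2r => //; rewrite -mulrA; apply: ler_piMr; first exact: ltW.
  by rewrite mulrC ler_pdivrMr // mul1r ler_nat.
have dE := diff_unique cL dfo.
have df : differentiable f z0 by apply/diff_locallyP; rewrite dE.
split=> // i; rewrite deriveE// dE /L/= /l (bigD1 i)//= mxE !eqxx mul1r big1 ?addr0//.
by move=> j ji; rewrite mxE (negPf ji) andbF mul0r.
Qed.

End Caratheodory.

(** * Directional derivatives and the integral form of the mean value theorem *)

Section Calculus.
Variable R : realType.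

(** A directional derivative only sees the function along a line, so it can be carried between
    spaces of different dimension: from a segment parameter to R^n, or from a product to one of its
    factors. *)
Lemma derive_reparam (V W : normedModType R) (f : V -> R) (g : W -> R) a b v w :
  (forall h : R, f (h *: v + a) = g (h *: w + b)) ->
  'D_v f a = 'D_w g b /\ (derivable f a v <-> derivable g b w).
Proof.
move=> fg.
have E : (fun h : R => h^-1 *: ((f \o shift a) (h *: v) - f a)) =
         (fun h : R => h^-1 *: ((g \o shift b) (h *: w) - g b)).
  apply/funext => h /=; rewrite fg; congr (_ *: (_ - _)).
  by have := fg 0; rewrite !scale0r !add0r.
by rewrite /derive /derivable E.
Qed.

Lemma derive_sum_coord n (g : 'rV[R]_n -> R) a v : differentiable g a ->
  'D_v g a = \sum_j v 0 j * 'D_(delta_mx 0 j) g a.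
Proof.
move=> dg; rewrite deriveE// [in LHS](row_sum_delta v) linear_sum.
by apply: eq_bigr => j _; rewrite linearZ /= -deriveE.
Qed.

Lemma continuous_row (T : topologicalType) n (f : T -> 'rV[R]_n) x :
  (forall j, {for x, continuous (fun y => f y 0 j)}) -> {for x, continuous f}.
Proof.
move=> cf; rewrite (_ : f = fun y => \sum_j f y 0 j *: delta_mx 0 j); last first.
  by apply/funext => y; exact: row_sum_delta.
have Fx := nbhs_filter x; apply: (cvg_sum_fin Fx) => j.
by apply: cvgZr_tmp; exact: cf.
Qed.

Lemma ndiff_on_continuous n k (U : set 'rV[R]_n) f x :
  ndiff_on k.+1 U f -> U x -> {for x, continuous f}.
Proof. by move=> [df _] /df; exact: differentiable_continuous. Qed.

Lemma ndiff_on_local n k (U : set 'rV[R]_n) f :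
  (forall x, U x -> exists W, [/\ open W, W x & ndiff_on k W f]) ->
  ndiff_on k U f.
Proof.
elim: k f => [//|k IHk] f H; split=> [x /H[W [_ Wx [+ _]]]|i]; first exact.
by apply: IHk => x /H[W [oW Wx [_ /(_ i)]]]; exists W.
Qed.

Lemma ndiff_onV n k (U : set 'rV[R]_n) f : open U ->
  (forall x, U x -> f x != 0) -> ndiff_on k U f ->
  ndiff_on k U (fun x => (f x)^-1).
Proof.
move=> oU f0; elim: k => [//|k IHk] fk.
have [df Df] := fk; have gk := IHk (ndiff_onW fk).
split=> [x Ux|i]; first by apply: differentiableV; [exact: df|exact: f0].
apply: ndiff_on_ext (ndiff_onM oU (ndiff_on_cst k U (-1))
  (ndiff_onM oU (ndiff_onM oU gk gk) (Df i))) => // x Ux.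
rewrite !fctE deriveV; [|exact: f0|by apply: diff_derivable; exact: df].
by rewrite -exprVn expr2 mulN1r scaleNr.
Qed.

Lemma cont01_comp (T : topologicalType) (h : R -> T) (f : T -> R) :
  (forall t, t \in `[0, 1] -> {for t, continuous h}) ->
  (forall t, t \in `[0, 1] -> {for h t, continuous f}) -> cont01 (f \o h).
Proof. by move=> ch cf t t01; apply: continuous_comp; [exact: ch|exact: cf]. Qed.

Lemma continuous_seg n (a v : 'rV[R]_n) : continuous (fun s : R => a + s *: v).
Proof.
move=> s; apply: cvgD; first exact: cvg_cst.
by apply: cvgZr_tmp; exact: cvg_id.
Qed.

(** The fundamental theorem of calculus for s |-> g(a + s v). At order 2 the first partial
    derivatives are themselves differentiable, hence continuous along the segment and integrable. *)
Lemma hadamard_seg n (Om : set 'rV[R]_n) g a v :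
  ndiff_on 2 Om g -> (forall s, s \in `[0, 1] -> Om (a + s *: v)) ->
  g (a + v) = g a + \sum_j v 0 j * int01 (fun s => 'D_(delta_mx 0 j) g (a + s *: v)).
Proof.
move=> [dg Dg] Oms.
have cD j : cont01 (fun s => 'D_(delta_mx 0 j) g (a + s *: v)).
  apply: (@cont01_comp _ (fun s : R => a + s *: v) ('D_(delta_mx 0 j) g)).
    by move=> t _; exact: continuous_seg.
  by move=> t /Oms Ot; exact: (@ndiff_on_continuous _ 0 Om _ _ (Dg j)) Ot.
have cDv j : cont01 (fun s => v 0 j * 'D_(delta_mx 0 j) g (a + s *: v)).
  by move=> t t01; apply: cvgM; [exact: cvg_cst|exact: cD].
have dF (s : R) : s \in `[0, 1] -> is_derive (s : R) (1 : R) (fun s : R => g (a + s *: v))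
    (\sum_j v 0 j * 'D_(delta_mx 0 j) g (a + s *: v)).
  move=> s01; have ds := dg _ (Oms s s01).
  have [|De dble] := @derive_reparam _ _ (fun s : R => g (a + s *: v)) g (s : R) (a + s *: v) (1 : R) v.
    move=> h; have -> : h *: (1 : R) = h by exact: mulr1.
    by rewrite scalerDl addrCA.
  by apply: DeriveDef; [apply/dble; exact: diff_derivable|rewrite De derive_sum_coord].
rewrite -[LHS](subrK (g a)) addrC; congr (_ + _).
have := int01_derive (cont01_sum cDv) dF; rewrite scale1r scale0r addr0 => <-.
by rewrite int01_sum//; apply: eq_bigr => j _; rewrite int01Z.
Qed.

End Calculus.

(** * Differentiation under the integral sign *)

Section ParametricIntegral.
Variable R : realType.

Lemma ball_seg n (z0 z : 'rV[R]_n) e s : ball z0 e z -> s \in `[0, 1] ->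
  ball z0 e (z0 + s *: (z - z0)).
Proof.
rewrite -ball_normE /ball_ /= => ze; rewrite in_itv /= => /andP[s0 s1].
rewrite opprD addrA subrr add0r normrN normrZ ger0_norm// distrC.
by apply: le_lt_trans ze; rewrite distrC ler_piMl.
Qed.

Definition pint k (g : 'rV[R]_(1 + k) -> R) (z : 'rV[R]_k) : R :=
  int01 (fun t => g (row_mx (const_mx t) z)).

Section Derivative.
Variables (k : nat) (Om : set 'rV[R]_(1 + k)) (O : set 'rV[R]_k).
Hypotheses (oOm : open Om) (oO : open O).
Hypothesis OOm : forall t z, t \in `[0, 1] -> O z -> Om (row_mx (const_mx t) z).
Variable g : 'rV[R]_(1 + k) -> R.
Hypothesis g2 : ndiff_on 2 Om g.

Let Dg i := 'D_(delta_mx 0 (rshift 1 i)) g.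

(** [hadamard_seg] in the variable z, integrated over t, gives an expansion of [pint g] at z0 whose
    coefficients are iterated integrals of the partial derivatives of g. These are continuous in z,
    so [caratheodory_diff] concludes without any exchange of limit and integral. *)
Lemma pint_diff z0 : O z0 -> differentiable (pint g) z0 /\
  forall i, 'D_(delta_mx 0 i) (pint g) z0 = pint (Dg i) z0.
Proof.
move=> Oz0.
(* For q = (s, (t, z)) this is (t, z0 + s (z - z0)), written as base point plus s times direction to
   match [hadamard_seg]. *)
pose A (q : R * (R * 'rV[R]_k)) : 'rV[R]_(1 + k) :=
  row_mx (const_mx q.2.1) z0 + q.1 *: row_mx 0 (q.2.2 - z0).
have AE q : A q = row_mx (const_mx q.2.1) (z0 + q.1 *: (q.2.2 - z0)).
  by rewrite /A scale_row_mx add_row_mx scaler0 addr0.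
have c1 : continuous (fun q : R * (R * 'rV[R]_k) => q.1) by move=> q; exact: cvg_fst.
have c2 : continuous (fun q : R * (R * 'rV[R]_k) => q.2.1).
  by move=> q; apply: continuous_comp; [exact: cvg_snd|exact: cvg_fst].
have c3 : continuous (fun q : R * (R * 'rV[R]_k) => q.2.2).
  by move=> q; apply: continuous_comp; [exact: cvg_snd|exact: cvg_snd].
have cA : continuous A.
  move=> q; apply: continuous_row => j; rewrite -(splitK j).
  case: (fintype.split j) => i /=.
    rewrite (_ : (fun _ => _) = fun q : R * (R * 'rV[R]_k) => q.2.1); first exact: c2.
    by apply/funext => q'; rewrite AE row_mxEl mxE.
  rewrite (_ : (fun _ => _) = fun q : R * (R * 'rV[R]_k) => z0 0 i + q.1 * (q.2.2 0 i - z0 0 i)).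
    apply: cvgD; first exact: cvg_cst.
    apply: cvgM; first exact: c1.
    apply: cvgB; last exact: cvg_cst.
    apply: (@continuous_comp _ _ _ (fun q : R * (R * 'rV[R]_k) => q.2.2)
      (fun v : 'rV[R]_k => v 0 i)); first exact: c3.
    exact: coord_continuous.
  by apply/funext => q'; rewrite AE row_mxEr !mxE.
(* Pairs (t, z) whose whole segment from (t, z0) to (t, z) stays in [Om]; compactness of the range
   of s makes this set open, as the continuity of the inner integral requires. *)
pose O' := [set w : R * 'rV[R]_k | forall s, s \in `[0, 1] -> Om (A (s, w))].
have oO' : open O'.
  rewrite openE => w Ow.
  have /compact_near_coveringP/near_covering_withinP cov := @segment_compact R 0 1.
  suff : \forall w' \near w, `[0, 1] `<=` [set s | Om (A (s, w'))].
    by apply: filterS => w' H s s01; exact: H.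
  apply: (cov _ (nbhs w) (fun w' s => Om (A (s, w'))) (nbhs_filter w)) => s s01.
  have [[B C] /= [sB wC] BC] : nbhs (s, w) (A @^-1` Om).
    by apply: cA; apply: open_nbhs_nbhs; split=> //; exact: Ow.
  by exists (B, C) => //= -[s' w'] [/= Bs Cw] _; exact: (BC (s', w')).
have cDg i x : Om x -> {for x, continuous (Dg i)}.
  by move: g2 => [_ /(_ (rshift 1 i)) h]; exact: (@ndiff_on_continuous _ _ 0 Om _ _ h).
pose K i (w : R * 'rV[R]_k) := int01 (fun s => Dg i (A (s, w))).
have cK i w : O' w -> {for w, continuous (K i)}.
  apply: (@int01_continuous _ _ (fun s w => Dg i (A (s, w)))) => // s w' s01 Ow'.
  rewrite (_ : (fun _ => _) = Dg i \o A); last by apply/funext => -[].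
  by apply: continuous_comp; [exact: cA|exact/cDg/Ow'].
have [e e0 eO] : exists2 e : R, 0 < e & ball z0 e `<=` O.
  by apply/nbhs_ballP; exact: open_nbhs_nbhs.
have BO' t z : t \in `[0, 1] -> ball z0 e z -> O' (t, z).
  by move=> t01 ze s s01; rewrite AE; apply: OOm => //; apply: eO; exact: ball_seg.
pose u i z := int01 (fun t => K i (t, z)).
have cu i : {for z0, continuous (u i)}.
  apply: (@int01_continuous _ _ (fun t z => K i (t, z)) (ball z0 e)).
  - exact: ball_open.
  - move=> t z t01 ze; rewrite (_ : (fun _ => _) = K i); last by apply/funext => -[].
    exact/cK/BO'.
  - exact: ballxx.
have cKt i z : ball z0 e z -> cont01 (fun t => K i (t, z)).
  move=> ze; apply: (@cont01_comp _ _ (fun t : R => (t, z)) (K i)) => t t01.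
    have hs : s @[s --> t] --> t by exact: cvg_id.
    have hz : z @[s --> t] --> z by exact: cvg_cst.
    exact: cvg_pair hs hz.
  exact/cK/BO'.
have cg z : ball z0 e z -> cont01 (fun t => g (row_mx (const_mx t) z)).
  move=> ze; rewrite (_ : (fun _ => _) = g \o (fun t : R => A (1, (t, z)))); last first.
    by apply/funext => t; rewrite /= AE/= scale1r addrC subrK.
  apply: (@cont01_comp _ _ (fun t : R => A (1, (t, z))) g) => t t01.
    apply: (@continuous_comp _ _ _ (fun t : R => (1 : R, (t, z))) A); last exact: cA.
    have h1 : (1 : R) @[s --> t] --> (1 : R) by exact: cvg_cst.
    have hs : s @[s --> t] --> t by exact: cvg_id.
    have hz : z @[s --> t] --> z by exact: cvg_cst.
    exact: cvg_pair h1 (cvg_pair hs hz).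
  apply: (@ndiff_on_continuous _ _ 1 Om) => //; apply: BO' => //.
  by rewrite in_itv/= ler01 lexx.
have [|//|df Df] := @caratheodory_diff _ _ (pint g) u z0.
  have : \forall z \near z0, ball z0 e z by exact: nbhsx_ballx.
  apply: filterS => z ze.
  rewrite /pint.
  rewrite (@eq_int01 _ (fun t => g (row_mx (const_mx t) z)) (fun t =>
    g (row_mx (const_mx t) z0) + \sum_i (z 0 i - z0 0 i) * K i (t, z))).
    have cs i : cont01 (fun t => (z 0 i - z0 0 i) * K i (t, z)).
      by move=> t t01; apply: cvgM; [exact: cvg_cst|exact: cKt].
    rewrite int01D; [|exact/cg/ballxx|exact: cont01_sum].
    rewrite int01_sum//; congr (_ + _); apply: eq_bigr => i _.
    by rewrite int01Z//; exact: cKt.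
  move=> t t01.
  have := hadamard_seg (a := row_mx (const_mx t) z0) (v := row_mx 0 (z - z0)) g2.
  rewrite add_row_mx addr0 (addrC z0) subrK => -> => [|s s01]; last first.
    by have := BO' _ _ t01 ze s s01; rewrite /A.
  congr (_ + _); rewrite big_split_ord big_ord1 /= row_mxEl mxE mul0r add0r.
  by apply: eq_bigr => i _; rewrite row_mxEr !mxE.
split=> // i; rewrite Df /u /pint; apply: eq_int01 => t t01.
rewrite /K -[RHS]int01_cst; apply: eq_int01 => s _.
by rewrite AE /= subrr scaler0 addr0.
Qed.

End Derivative.

(** Every differentiation consumes one order of g and [pint_diff] asks for two orders to produce
    one, whence the shift; it is harmless for smooth g. *)
Lemma ndiff_on_pint j k (Om : set 'rV[R]_(1 + k)) (O : set 'rV[R]_k) g :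
  open Om -> open O ->
  (forall t z, t \in `[0, 1] -> O z -> Om (row_mx (const_mx t) z)) ->
  ndiff_on j.+1 Om g -> ndiff_on j O (pint g).
Proof.
move=> oOm oO OOm; elim: j g => [//|j IHj] g gj.
have g2 : ndiff_on 2 Om g.
  by move: gj; clear; elim: j => // j IHj /ndiff_onW/IHj.
have H := pint_diff oOm oO OOm g2.
split=> [z /H[]//|i].
have [_ /(_ (rshift 1 i))/IHj] := gj.
by apply: ndiff_on_ext => // z /H[_ ->].
Qed.

Lemma smooth_on_pint k (Om : set 'rV[R]_(1 + k)) (O : set 'rV[R]_k) g :
  open Om -> open O ->
  (forall t z, t \in `[0, 1] -> O z -> Om (row_mx (const_mx t) z)) ->
  smooth_on Om g -> smooth_on O (pint g).
Proof. by move=> ? ? ? gs j; apply: ndiff_on_pint (gs j.+1). Qed.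

End ParametricIntegral.

(** * Hadamard's lemma and smooth functions on manifolds *)

Section SmoothTools.
Variable R : realType.

Lemma smooth_on_add n (U : set 'rV[R]_n) f g : open U ->
  smooth_on U f -> smooth_on U g -> smooth_on U (fun x => f x + g x).
Proof. by move=> oU fs gs; exact: (smooth_onD oU fs gs). Qed.

Lemma smooth_on_mul n (U : set 'rV[R]_n) f g : open U ->
  smooth_on U f -> smooth_on U g -> smooth_on U (fun x => f x * g x).
Proof. by move=> oU fs gs; exact: (smooth_onM oU fs gs). Qed.

Lemma smooth_on_opp n (U : set 'rV[R]_n) f : open U ->
  smooth_on U f -> smooth_on U (fun x => - f x).
Proof.
move=> oU fs; apply: smooth_on_ext (smooth_on_mul oU (smooth_on_cst U (-1)) fs) => //.
by move=> x _; rewrite mulN1r.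
Qed.

Lemma smooth_on_sub n (U : set 'rV[R]_n) f g : open U ->
  smooth_on U f -> smooth_on U g -> smooth_on U (fun x => f x - g x).
Proof. by move=> oU fs gs; apply: smooth_on_add => //; exact: smooth_on_opp. Qed.

Lemma smooth_onS n (U V : set 'rV[R]_n) f : U `<=` V -> smooth_on V f -> smooth_on U f.
Proof. by move=> UV fs k; exact: ndiff_onS (fs k). Qed.

Lemma smooth_on_derive n (U : set 'rV[R]_n) f i :
  smooth_on U f -> smooth_on U ('D_(delta_mx 0 i) f).
Proof. by move=> fs k; have [_] := fs k.+1; apply. Qed.

Lemma smooth_on_continuous n (U : set 'rV[R]_n) f x :
  smooth_on U f -> U x -> {for x, continuous f}.
Proof. by move=> fs; exact: ndiff_on_continuous (fs 1). Qed.

Lemma smooth_on_local n (U : set 'rV[R]_n) f :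
  (forall x, U x -> exists W, [/\ open W, W x & smooth_on W f]) -> smooth_on U f.
Proof.
by move=> H k; apply: ndiff_on_local => x /H[W [oW Wx /(_ k)]]; exists W.
Qed.

Lemma smooth_on_inv n (U : set 'rV[R]_n) f : open U ->
  (forall x, U x -> f x != 0) -> smooth_on U f -> smooth_on U (fun x => (f x)^-1).
Proof. by move=> oU f0 fs k; exact: ndiff_onV. Qed.

(** The quotients are the integrals of the partial derivatives of h over the segment from b to a.
    They are smooth in both end points jointly, so arbitrary smooth functions may be substituted for
    the coordinates of a and b. *)
Lemma hadamard n (h : Cinf (euclid R n)) : exists H : 'I_n -> Cinf (euclid R (n + n)),
  forall a b : 'rV[R]_n, h a = h b + \sum_i (a 0 i - b 0 i) * H i (row_mx a b).
Proof.
have hs := euclid_smooth (cfunP h).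
(* The point [b + t (a - b)] as a function of [(t, (a, b))]. *)
pose c (x : 'rV[R]_(1 + (n + n))) : 'rV[R]_n :=
  let b := rsubmx (rsubmx x) in b + lsubmx x 0 0 *: (lsubmx (rsubmx x) - b).
have cs j : smooth_on setT (fun x => c x 0 j).
  rewrite (_ : (fun _ => _) = fun x : 'rV[R]_(1 + (n + n)) =>
     x 0 (rshift 1 (rshift n j)) + x 0 (lshift (n + n) 0) *
       (x 0 (rshift 1 (lshift n j)) - x 0 (rshift 1 (rshift n j)))); last first.
    by apply/funext => x; rewrite !mxE.
  have oT := @openT 'rV[R]_(1 + (n + n)).
  apply: smooth_on_add => //; first exact: smooth_on_coord.
  apply: smooth_on_mul => //; first exact: smooth_on_coord.
  by apply: smooth_on_sub => //; exact: smooth_on_coord.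
have Hs i : pint ('D_(delta_mx 0 i) h \o c) \in msmooth_pred (M := euclid R (n + n)).
  apply/asboolP/msmooth_euclid; apply: (@smooth_on_pint _ _ setT setT) => //.
  - exact: openT.
  - exact: openT.
  apply: (@smooth_on_comp _ _ _ setT setT) => //; [exact: openT|exact: openT|].
  exact: smooth_on_derive.
exists (fun i => MkCinf (Hs i)) => a b /=.
have ab : b + (a - b) = a by rewrite addrC subrK.
have hab : h (b + (a - b)) = h a := congr1 (cfun h) ab.
have E := @hadamard_seg _ _ setT h b (a - b) (hs 2) (fun _ _ => I).
apply: etrans (etrans (esym hab) E) _.
apply: (congr1 (fun s => h b + s)).
apply: eq_bigr => i _.
rewrite 2!mxE.
apply: (congr1 (fun s => (a 0 i - b 0 i) * s)).
apply: eq_int01 => t _ /=.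
by rewrite /c /= !(row_mxKr, row_mxKl) mxE.
Qed.

End SmoothTools.

Section ManifoldTools.
Variables (R : realType) (M : premanifold R).
Implicit Types f g : M -> R.

Lemma msmooth_local f :
  (forall x, exists W : set M, [/\ open W, W x & msmooth_on W f]) -> msmooth f.
Proof.
move=> H c Ac; apply: smooth_on_local => _ [x [cx _] <-].
have [W [oW Wx Ws]] := H x.
exists (cmap c @` (cdom c `&` W)); split; [exact: cimg_openI|by exists x|exact: Ws].
Qed.

Lemma msmooth_continuous f : msmooth f -> continuous f.
Proof.
move=> fs x; have [c Ac cx] := patlas_cover x.
have cxi : (cmap c @` (cdom c `&` setT)) (cmap c x) by exists x.
have h1 : {for x, continuous ((f \o cinv c) \o cmap c)}.
  apply: continuous_comp; first by apply: cmap_continuous; rewrite inE.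
  exact: smooth_on_continuous (fs c Ac) cxi.
move: h1; rewrite /prop_for /continuous_at /= cmapK ?inE//; apply: cvg_trans.
apply: near_eq_cvg; apply: filterS (open_nbhs_nbhs (conj (cdom_open c) cx)) => y cy /=.
by rewrite cmapK ?inE.
Qed.

Lemma cinf_unit (f : Cinf M) : (forall x, f x != 0) -> exists g : Cinf M, f * g = 1.
Proof.
move=> f0.
have gs : (fun x => (f x)^-1) \in msmooth_pred (M := M).
  apply/asboolP => c Ac; apply: smooth_on_inv; [exact/cimg_openI/openT| |exact: cfunP].
  by move=> x _; exact: f0.
by exists (MkCinf gs); apply: cinf_ext => x /=; rewrite !fctE/= mulfV.
Qed.

Lemma msmooth_chart (d : chart R M (pdim M)) j : patlas d ->
  msmooth_on (cdom d) (fun y => cmap d y 0 j).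
Proof. by move=> Ad c Ac; exact: patlas_compat. Qed.

End ManifoldTools.

(** * Descent of the smooth operations *)

Section InducedStructure.
Variables (R : realType) (X : premanifold R) (r : nat) (E : cvbundle X r).
Variables (M : premanifold R) (phi : Cinf M -> endsec E).
Hypothesis phi_hom : ring_hom_over phi.

(** The difference h(a) - h(b) lies in the ideal generated by the [a i - b i], all of which [phi]
    kills. *)
Lemma ring_hom_over_subst n (h : Cinf (euclid R n)) (a b : 'I_n -> Cinf M) :
  (forall i, phi (a i) = phi (b i)) -> phi (cinf_subst h a) = phi (cinf_subst h b).
Proof.
move=> ab; have [phiB [_ phiM] _] := phi_hom.
pose phiA : {additive Cinf M -> endsec E} :=
  HB.pack phi (GRing.isZmodMorphism.Build _ _ phi phiB).
have [H HE] := hadamard h.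
pose ab2 (k : 'I_(n + n)) := match fintype.split k with inl i => a i | inr i => b i end.
have -> : cinf_subst h a = cinf_subst h b +
    \sum_i (a i - b i) * cinf_subst (H i) ab2.
  apply: cinf_ext => x /=.
  transitivity (h (\row_i b i x) + (\sum_i (a i - b i) * cinf_subst (H i) ab2 : Cinf M) x) => //.
  rewrite (HE _ (\row_i b i x)); congr (_ + _).
  rewrite (@big_morph _ _ (fun f : Cinf M => f x) 0 +%R 0 +%R)//.
  apply: eq_bigr => i _; rewrite !mxE; congr (_ * _); congr (cfun (H i) _).
  apply/rowP => k; rewrite !mxE /ab2.
  by case: fintype.split => j; rewrite mxE.
have phiD f g : phi (f + g) = phi f + phi g := raddfD phiA f g.
have phiS (F : 'I_n -> Cinf M) : phi (\sum_i F i) = \sum_i phi (F i) := raddf_sum phiA _ _ _.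
rewrite phiD phiS big1 ?addr0// => i _.
by rewrite phiM phiB ab subrr mul0r.
Qed.

Let mk (f : Cinf M) : range phi := exist _ (phi f) (mem_set (imageT phi f)).

Let pre_ex (v : range phi) : exists f, phi f = val v.
Proof. by have [f _ <-] := set_mem (valP v); exists f. Qed.

Let pre (v : range phi) : Cinf M := projT1 (cid (pre_ex v)).

Let preK v : phi (pre v) = val v.
Proof. exact: projT2 (cid (pre_ex v)). Qed.

(** Computed on arbitrarily chosen preimages; [ring_hom_over_subst] makes the value independent of
    the choice, and the composition law rests on that. *)
Let op n (h : Cinf (euclid R n)) (v : 'I_n -> range phi) : range phi :=
  mk (cinf_subst h (pre \o v)).

Let op_coord n (i : 'I_n) v : op (euclid_coord R i) v = v i.
Proof. by apply: val_inj; rewrite /op cinf_substE /= preK. Qed.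

Let op_subst m n (g : Cinf (euclid R m)) (h : 'I_m -> Cinf (euclid R n)) v :
  op (cinf_subst g h) v = op g (fun j => op (h j) v).
Proof.
apply: val_inj; rewrite /op cinf_substA /=; apply: ring_hom_over_subst => i.
by rewrite /= preK.
Qed.

(** The last clause serves maps that factor through C^oo(M): with M a product, it makes the original
    homomorphism and the inclusion of C^oo(X) homomorphisms into the image of the extension. *)
Lemma range_cinf_ring : exists S : cinf_ring R (range phi),
  [/\ cinf_compatible S, cinf_hom_into (Cinf_ring M) S phi &
      forall (N : premanifold R) (f : Cinf N -> Cinf M),
        cinf_hom (Cinf_ring N) (Cinf_ring M) f ->
        cinf_hom_into (Cinf_ring N) S (phi \o f)].
Proof.
have [phiB [phi1 phiM] phiZ] := phi_hom.
pose phiA : {additive Cinf M -> endsec E} :=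
  HB.pack phi (GRing.isZmodMorphism.Build _ _ phi phiB).
exists (CinfRing op_coord op_subst); split.
- split=> [v|v|a v|v] /=.
  + rewrite -!preK -(raddfD phiA)/=; congr (phi _); apply: cinf_ext => x /=.
    by rewrite !fctE/= !mxE.
  + rewrite -!preK -phiM/=; congr (phi _); apply: cinf_ext => x /=.
    by rewrite !fctE/= !mxE.
  + rewrite -!preK -phiZ/=; congr (phi _); apply: cinf_ext => x /=.
    by rewrite !fctE/= !mxE.
  + by rewrite -phi1; congr (phi _); exact: cinf_ext.
- exists mk => // n h a; apply: val_inj => /=; apply: ring_hom_over_subst => i.
  by rewrite /= preK.
- move=> N f fhom; exists (mk \o f) => // n h a; apply: val_inj => /=.
  rewrite fhom /=; apply: ring_hom_over_subst => i.
  by rewrite /= preK.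
Qed.

End InducedStructure.

(** * Bump functions and proper functions *)

Section Bumps.
Variables (R : realType) (M : manifold R).

(** In a partition of unity subordinate to the cover by V and the complement of K, the function of
    the latter vanishes on K, so the function of V is 1 there. *)
Lemma cinf_urysohn (K V : set M) : closed K -> open V -> K `<=` V ->
  exists f : Cinf M, (forall x, K x -> f x = 1) /\ closure [set x | f x != 0] `<=` V.
Proof.
move=> cK oV KV; pose O : set (set M) := [set V; ~` K].
have [||rho [rs rsupp _ rsum]] := @m_partitions _ M O.
- by move=> U [->|->] //; exact: closed_openC.
- by rewrite bigcup_setU !bigcup_set1 -subTset => x _; case: (pselect (K x)) => [/KV|]; [left|right].
have OV : O V by left.
have OK : O (~` K) by right.
exists (MkCinf (asboolT (rs V OV).1 : rho V \in msmooth_pred (M := M))).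
split=> [x Kx|]; last exact: rsupp.
rewrite /= -(rsum x) (fsbigD1 V)//=; last exact: finite_set2.
rewrite fsbig1 ?addr0// => U [[->|->]] //= _.
apply/eqP/negPn/negP => h.
by have : (~` K) x by apply: rsupp => //; exact: subset_closure.
Qed.

End Bumps.

Section Boxes.
Variables (R : realType) (n : nat).
Implicit Types x v : 'rV[R]_n.

Definition box x (e : R) : set 'rV[R]_n :=
  [set v | forall i, v 0 i \in `[x 0 i - e, x 0 i + e]].

Lemma box_compact x e : compact (box x e).
Proof.
apply: (@rV_compact _ _ (fun i => [set` `[x 0 i - e, x 0 i + e]])) => i.
exact: segment_compact.
Qed.

Lemma norm_le_coord v e : 0 <= e -> (forall i, `|v 0 i| <= e) -> `|v| <= e.
Proof.
move=> e0 ve; rewrite [`|v|]mx_normrE; apply: bigmax_le => // -[i j] _ /=.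
by rewrite (ord1 i).
Qed.

Lemma box_coord x e v : box x e v <-> forall i, `|v 0 i - x 0 i| <= e.
Proof. by split=> H i; have := H i; rewrite /= ?in_itv/= ler_distl. Qed.

Lemma ball_box x e : ball x e `<=` box x e.
Proof.
rewrite -ball_normE => v /= xv; apply/box_coord => i.
have := coord_le_norm (v - x) i; rewrite !mxE => /le_trans; apply.
by rewrite distrC ltW.
Qed.

Lemma box_ball x e e' : 0 <= e -> e < e' -> box x e `<=` ball x e'.
Proof.
move=> e0 ee' v /box_coord H; rewrite -ball_normE /ball_ /= distrC.
by apply: le_lt_trans ee'; apply: norm_le_coord => // i; rewrite !mxE.
Qed.

End Boxes.

Section ChartBumps.
Variables (R : realType) (M : manifold R).

(** Nested coordinate balls of radii e/4 < e/2 < e; the compact cubes between them pull back to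
    closed sets because M is Hausdorff. Two bumps are built because coordinates multiplied by [psi]
    remain the true coordinates wherever [eta] lives. *)
Lemma cinf_chart_bump (d : chart R M (pdim M)) y0 : patlas d -> cdom d y0 ->
  exists (eta psi : Cinf M) (B : set 'rV[R]_(pdim M)),
  [/\ compact B, B `<=` cmap d @` cdom d,
      forall y, psi y != 0 -> B (cmap d y),
      closure [set y | psi y != 0] `<=` cdom d &
      eta y0 != 0 /\ forall y, eta y != 0 -> psi y = 1].
Proof.
move=> Ad dy0; set p0 := cmap d y0.
have [e e0 eim] : exists2 e : R, 0 < e & ball p0 e `<=` cmap d @` cdom d.
  by apply/nbhs_ballP/open_nbhs_nbhs; split; [exact: cimg_open|exists y0].
pose W e' := cdom d `&` cmap d @^-1` ball p0 e'.
have oW e' : open (W e').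
  rewrite openE => y [dy yb]; apply: filterI.
    by apply: open_nbhs_nbhs; split=> //; exact: cdom_open.
  apply: (cmap_continuous (mem_set dy)).
  by apply: open_nbhs_nbhs; split=> //; exact: ball_open.
pose K e' := cinv d @` box p0 e'.
have bim e' : 0 <= e' -> e' < e -> box p0 e' `<=` cmap d @` cdom d.
  by move=> e'0 e'e v /(box_ball e'0 e'e)/eim.
have cK e' : 0 <= e' -> e' < e -> closed (K e').
  move=> e'0 e'e; apply: compact_closed; first exact: m_hausdorff.
  apply: continuous_compact; last exact: box_compact.
  apply: continuous_in_subspaceT => v; rewrite inE => /(bim _ e'0 e'e) vi.
  by apply: cinv_continuous; rewrite inE.
have WK e' : W e' `<=` K e'.
  by move=> y [dy yb]; exists (cmap d y); [exact: ball_box|rewrite cmapK ?inE].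
have KW e' e'' : 0 <= e' -> e' < e'' -> e'' <= e -> K e' `<=` W e''.
  move=> e'0 e'e'' e''e _ [v vb <-].
  have [y dy yv] := bim _ e'0 (lt_le_trans e'e'' e''e) v vb.
  by rewrite -yv cmapK ?inE//; split=> //=; rewrite yv; exact: box_ball vb.
have e2 : 0 < e / 2 by rewrite divr_gt0.
have e4 : 0 < e / 2 / 2 by rewrite divr_gt0.
have e2e : e / 2 < e by rewrite ltr_pdivrMr// ltr_pMr// ltr1n.
have e4e : e / 2 / 2 < e / 2 by rewrite ltr_pdivrMr// ltr_pMr// ltr1n.
have [psi [psi1 psis]] := cinf_urysohn
  (cK _ (ltW e4) (lt_trans e4e e2e)) (oW (e / 2)) (KW _ _ (ltW e4) e4e (ltW e2e)).
have c0 : closed [set y0].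
  by apply: accessible_closed_set1; apply: hausdorff_accessible; exact: m_hausdorff.
have [|eta [eta1 etas]] := cinf_urysohn c0 (oW (e / 2 / 2)).
  by move=> _ ->; split=> //; exact: ballxx.
exists eta, psi, (box p0 (e / 2)); split.
- exact: box_compact.
- by apply: bim => //; exact: ltW.
- move=> y y0'; have [dy] : W (e / 2) y by apply: psis; exact: subset_closure.
  exact: ball_box.
- by move=> y /psis[].
- split; first by rewrite eta1// oner_eq0.
  by move=> y yn; apply/psi1/WK/etas; exact: subset_closure.
Qed.

(** The squared norm of a closed embedding. Sublevel sets are carried into cubes, and compactness
    comes back to M because the embedding is injective and closed. *)
Lemma cinf_proper : exists rho : Cinf M, forall c, compact [set x | rho x <= c].
Proof.
have [N [iota [ios _ iinj icl]]] := @m_embedding _ M.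
pose u j : Cinf M := MkCinf (asboolT (ios j) : (fun x => iota x 0 j) \in msmooth_pred (M := M)).
pose rho : Cinf M := \sum_j u j * u j; exists rho => c F FF FK.
have rhoE x : rho x = \sum_j iota x 0 j ^+ 2.
  rewrite /rho (@big_morph _ _ (fun f : Cinf M => f x) 0 +%R 0 +%R)//.
have cK : closed [set x | rho x <= c].
  rewrite (_ : [set x | _] = rho @^-1` [set y | y <= c])//.
  apply: preimage_closed; last exact: closed_le.
  by move=> x _; exact: (msmooth_continuous (cfunP rho)).

(* On the sublevel set each coordinate has square at most |c|, hence at most (1 + |c|)^2. *)
have GB : F (iota @^-1` box 0 (1 + `|c|)).
  apply: filterS FK => x /= xc; apply/box_coord => j; rewrite mxE subr0.
  have h : iota x 0 j ^+ 2 <= `|c|.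
    apply: le_trans (ler_norm c); apply: le_trans xc; rewrite rhoE (bigD1 j)//=.
    by rewrite lerDl sumr_ge0// => k _; exact: sqr_ge0.
  rewrite -[leRHS]ger0_norm ?addr_ge0// -ler_sqr ?nnegrE// !real_normK ?num_real//.
  by apply: (le_trans h); have := normr_ge0 c; nra.
(* A cluster point of the image filter lies in the closed image of every [closure A] with A in F; by
   injectivity all these memberships come from one point y of M. *)
have [v [Bv Gv]] := @box_compact R N 0 (1 + `|c|) (iota @ F) _ GB.
have vA A : F A -> (iota @` closure A) v.
  move=> FA; apply: icl; first exact: closed_closure.
  move: Gv; rewrite clusterE => /(_ (iota @` closure A)); apply.
  suff : F (iota @^-1` (iota @` closure A)) by [].
  by apply: filterS FA => x Ax; exists x => //; exact: subset_closure.
have [y _ yv] := vA _ (@filterT _ F _).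
have yA A : F A -> closure A y.
  by move=> /vA[z Az]; rewrite -yv => /iinj <-.
exists y; split; first by have := yA _ FK; rewrite closure_id in cK; rewrite -cK.
by rewrite clusterE => A /yA.
Qed.

(** Replaces the extraction of a finite subcover. For nonnegative f and g, f + g <= 0 forces f <= 0
    and g <= 0, so the sets where some f of B is <= 0 on K form a filter base; if none were empty, a
    cluster point would contradict positivity near it. *)
Lemma cinf_cover (K : set M) (B : set (Cinf M)) : compact K -> B 0 ->
  (forall f g, B f -> B g -> B (f + g)) -> (forall f x, B f -> 0 <= f x) ->
  (forall x, K x -> exists2 f, B f & 0 < f x) ->
  exists2 f, B f & forall x, K x -> 0 < f x.
Proof.
move=> cK B0 BD Bge Kp; apply: contrapT => H.
pose S (f : Cinf M) := K `&` [set x | f x <= 0].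
have FF : ProperFilter (filter_from B S).
  apply: filter_from_proper.
    apply: filter_from_filter; first by exists 0.
    move=> f g Bf Bg; exists (f + g); first exact: BD.
    move=> x [Kx] /= fgx; have [f0 g0] := (Bge f x Bf, Bge g x Bg).
    split; split=> //=; apply: le_trans fgx; rewrite /= ?lerDl// lerDr//.
  move=> f Bf; apply: contrapT => nS; apply: H; exists f => // x Kx.
  by rewrite ltNge; apply/negP => fx; apply: nS; exists x.
have [|x [Kx]] := cK (filter_from B S) FF; first by exists 0 => // x [].
have [f Bf fx] := Kp x Kx.
move=> /(_ (S f) [set x | 0 < f x]) [||y [[_ /=]]].
- by exists f.
- suff : nbhs x (f @^-1` [set y | 0 < y]) by [].
  apply: (msmooth_continuous (cfunP f) (x := x)).
  by apply: open_nbhs_nbhs; split=> //; exact: open_gt.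
- by move=> /le_lt_trans h /h; rewrite ltxx.
Qed.

End ChartBumps.

(** * Homomorphisms into matrix algebras *)

Section MatrixAlgebraHom.
Variables (R : realType) (M : premanifold R) (N : nat).

Definition mxalg (chi : Cinf M -> 'M[R]_N) : Prop :=
  [/\ forall f g, chi (f + g) = chi f + chi g,
      forall f g, chi (f * g) = chi f *m chi g,
      chi 1 = 1%:M &
      forall a f, chi (a *: f) = a *: chi f].

Variable chi : Cinf M -> 'M[R]_N.
Hypothesis chi_alg : mxalg chi.

Lemma mxalgD f g : chi (f + g) = chi f + chi g. Proof. by case: chi_alg. Qed.
Lemma mxalgM f g : chi (f * g) = chi f *m chi g. Proof. by case: chi_alg. Qed.
Lemma mxalg1 : chi 1 = 1%:M. Proof. by case: chi_alg. Qed.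
Lemma mxalgZ a f : chi (a *: f) = a *: chi f. Proof. by case: chi_alg. Qed.
Lemma mxalg0 : chi 0 = 0. Proof. by rewrite -(scale0r 0) mxalgZ scale0r. Qed.
Lemma mxalgN f : chi (- f) = - chi f. Proof. by rewrite -scaleN1r mxalgZ scaleN1r. Qed.
Lemma mxalgB f g : chi (f - g) = chi f - chi g. Proof. by rewrite mxalgD mxalgN. Qed.
Lemma mxalgC f g : chi f *m chi g = chi g *m chi f.
Proof. by rewrite -!mxalgM mulrC. Qed.
Lemma mxalg_sum (I : Type) (s : seq I) (F : I -> Cinf M) :
  chi (\sum_(i <- s) F i) = \sum_(i <- s) chi (F i).
Proof. by rewrite (big_morph chi mxalgD mxalg0). Qed.
Lemma mxalgA a : chi (a *: (1 : Cinf M)) = a%:M.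
Proof. by rewrite mxalgZ mxalg1 scalemx1. Qed.

Lemma mxalg_unit (f : Cinf M) : (forall y, f y != 0) -> chi f \in unitmx.
Proof.
by move=> /cinf_unit[g fg]; have := mxalgM f g; rewrite fg mxalg1 => /esym/mulmx1_unit[].
Qed.

End MatrixAlgebraHom.

(* The eigenvalues of [chi w] are values of [w]: if [z] is one and
   [(w - Re z)^2 + (Im z)^2] vanished nowhere, it would be invertible. *)
Lemma mxalg_split (R : realType) (M : premanifold R) (N : nat)
    (chi : Cinf M -> 'M[R]_N) (w : Cinf M) : mxalg chi ->
  exists s : seq R, [/\ size s = N, forall l, l \in s -> exists y, w y = l &
    chi (\prod_(l <- s) (w - l *: (1 : Cinf M))) = 0].
Proof.
(* Polynomial evaluation at a matrix needs a positive size; in size 0 all matrices are equal and the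
   empty list of eigenvalues works. *)
case: N chi => [|N] chi ca; first by exists [::]; split=> //; exact: flatmx0.
pose rc : {rmorphism R -> R[i]} := real_complex R.
have [zs] := closed_field_poly_normal (map_poly rc (char_poly (chi w))).
rewrite (monicP _) ?scale1r; last by rewrite map_monic char_poly_monic.
move=> zsE.
have root_val z : z \in zs -> exists2 y, w y = complex.Re z & z = rc (complex.Re z).
  move=> zzs.
  have /eigenvalueP[v vz v0] : eigenvalue (map_mx rc (chi w)) z.
    by rewrite eigenvalue_root_char -map_char_poly zsE root_prod_XsubC.
  case: z zzs vz => a b _ vz /=.
  pose q := (w - a *: (1 : Cinf M)) * (w - a *: (1 : Cinf M)) + (b ^+ 2) *: (1 : Cinf M).
  have [[y qy]|nq] := pselect (exists y, q y = 0).
    have qE : q y = (w y - a * 1) * (w y - a * 1) + b ^+ 2 * 1 by [].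
    have {qE}qy : (w y - a) ^+ 2 + b ^+ 2 = 0.
      by move: qE; rewrite qy !mulr1 expr2.
    have /eqP := qy; rewrite paddr_eq0 ?sqr_ge0// !sqrf_eq0 subr_eq0.
    by move=> /andP[/eqP wy /eqP ->]; exists y.
  have qu : chi q \in unitmx.
    by apply: (mxalg_unit ca) => y; apply/eqP => qy; apply: nq; exists y.
  have vq : v *m map_mx rc (chi q) = 0.
    rewrite /q (mxalgD ca) (mxalgM ca) (mxalgB ca) !(mxalgA ca).
    have vD : v *m map_mx rc (chi w - a%:M) = ((a +i* b)%C - rc a) *: v.
      by rewrite map_mxB map_scalar_mx mulmxBr vz mul_mx_scalar scalerBl.
    rewrite map_mxD map_mxM map_scalar_mx mulmxDr mulmxA vD -scalemxAl vD.
    rewrite mul_mx_scalar scalerA -scalerDl [X in X *: _](_ : _ = 0) ?scale0r//.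
    by apply/eqP; rewrite eq_complex /=; simpc; rewrite expr2 addNr eqxx.
  have mqu : map_mx rc (chi q) \in unitmx by rewrite map_unitmx.
  by move/eqP: v0; case; rewrite -(mulmxK mqu v) vq mul0mx.
exists [seq complex.Re z | z <- zs]; split.
- rewrite size_map; have := congr1 (size \o val) zsE.
  by rewrite /= size_map_poly size_char_poly size_prod_XsubC => -[].
- by move=> l /mapP[z /root_val[y wy _] ->]; exists y.
have charE : char_poly (chi w) = \prod_(l <- [seq complex.Re z | z <- zs]) ('X - l%:P).
  apply: (map_poly_inj rc); rewrite zsE rmorph_prod big_map.
  apply: eq_big_seq => z zzs. have [_ _ zE] := root_val z zzs.
  by rewrite rmorphB/= map_polyX map_polyC/= -/(rc _) -zE.
have prodE s : chi (\prod_(l <- s) (w - l *: (1 : Cinf M))) = horner_mx (chi w) (\prod_(l <- s) ('X - l%:P)).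
  elim: s => [|l s IHs]; first by rewrite !big_nil (mxalg1 ca) -polyC1 horner_mx_C.
  rewrite !big_cons (mxalgM ca) IHs rmorphM/=; congr (_ *m _).
  by rewrite (mxalgB ca) (mxalgA ca) rmorphB/= horner_mx_X horner_mx_C.
by rewrite prodE -charE Cayley_Hamilton.
Qed.

(** * Newton interpolation at the eigenvalues *)

Section PolynomialReduction.
Variables (R : realType) (M : premanifold R) (N : nat) (T : Type) (D : set T).
Variable Phi : Cinf M -> T -> 'M[R]_N.
Hypothesis Phi_alg : forall p, D p -> mxalg (Phi^~ p).

(* [Phi] is taken at the point [pi s] underlying the parameter [s], which also
   records the values of the constant arguments below. *)
Definition fbdd (S : Type) (Q : set S) (pi : S -> T) (F : S -> Cinf M) : Prop :=
  exists C : R, forall s, Q s -> forall i j, `|Phi (F s) (pi s) i j| <= C.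

Section Closure.
Variables (S : Type) (Q : set S) (pi : S -> T).
Hypothesis QD : forall s, Q s -> D (pi s).
Implicit Types F G : S -> Cinf M.

Lemma fbdd1 : fbdd Q pi (fun=> 1).
Proof.
exists 1 => s /QD/Phi_alg/mxalg1 -> i j; rewrite mxE.
by case: (i == j); rewrite ?normr1 ?normr0.
Qed.

Lemma fbddD F G : fbdd Q pi F -> fbdd Q pi G -> fbdd Q pi (fun s => F s + G s).
Proof.
move=> [B FB] [C GC]; exists (B + C) => s Qs i j.
rewrite (mxalgD (Phi_alg (QD Qs))) mxE; apply: le_trans (ler_normD _ _) _.
by apply: lerD; [exact: FB|exact: GC].
Qed.

Lemma fbddM F G : fbdd Q pi F -> fbdd Q pi G -> fbdd Q pi (fun s => F s * G s).
Proof.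
move=> [B FB] [C GC]; exists (\sum_(k < N) B * C) => s Qs i j.
rewrite (mxalgM (Phi_alg (QD Qs))) mxE; apply: le_trans (ler_norm_sum _ _ _) _.
by apply: ler_sum => k _; rewrite normrM; apply: ler_pM => //; [exact: FB|exact: GC].
Qed.

Lemma fbddZ (a : S -> R) F (c : R) : (forall s, Q s -> `|a s| <= c) ->
  fbdd Q pi F -> fbdd Q pi (fun s => a s *: F s).
Proof.
move=> ac [C FC]; exists (c * C) => s Qs i j.
rewrite (mxalgZ (Phi_alg (QD Qs))) mxE normrM.
by apply: ler_pM => //; [exact: ac|exact: FC].
Qed.

Lemma fbdd_prod (J : Type) (r : seq J) (F : J -> S -> Cinf M) :
  (forall j, fbdd Q pi (F j)) -> fbdd Q pi (fun s => \prod_(j <- r) F j s).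
Proof.
move=> FB; elim: r => [|j r IHr].
  by have [C H] := fbdd1; exists C => s Qs i j; rewrite big_nil; exact: H.
have [C H] := fbddM (FB j) IHr.
by exists C => s Qs i k; rewrite big_cons; exact: H.
Qed.

Lemma eq_fbdd F G : (forall s, Q s -> F s = G s) -> fbdd Q pi F -> fbdd Q pi G.
Proof. by move=> FG [C H]; exists C => s Qs i j; rewrite -FG//; exact: H. Qed.

End Closure.

Lemma fbdd_comp (S S' : Type) (Q : set S) (Q' : set S') pi (g : S' -> S) F :
  (forall s, Q' s -> Q (g s)) -> fbdd Q pi F -> fbdd Q' (pi \o g) (F \o g).
Proof. by move=> QQ' [C H]; exists C => s /QQ'; exact: H. Qed.

Variables (m : nat) (w : 'I_m -> Cinf M) (c : R).
Hypothesis w_bdd : forall j, fbdd D id (fun=> w j).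
Variable lam : 'I_m -> T -> seq R.
Hypothesis lam_size : forall j p, D p -> size (lam j p) = N.
Hypothesis lam_bdd : forall j p l, D p -> l \in lam j p -> `|l| <= c.
Hypothesis lam0 : forall j p, D p ->
  Phi (\prod_(l <- lam j p) (w j - l *: (1 : Cinf M))) p = 0.

Definition newton (k : 'I_m -> nat) (p : T) : Cinf M :=
  \prod_(j < m) \prod_(l <- take (k j) (lam j p)) (w j - l *: (1 : Cinf M)).

Lemma nth_lam_bdd j p n : D p -> (n < N)%N -> `|(lam j p)`_n| <= c.
Proof. by move=> Dp nN; apply: lam_bdd (mem_nth _ _) => //; rewrite lam_size. Qed.

Lemma newton_bdd k : fbdd D id (newton k).
Proof.
apply: (@fbdd_prod _ D id) => // j; elim: (k j) => [|n IHn].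
  apply: eq_fbdd (fbdd1 (Q := D) (pi := id) _) => // p Dp.
  by rewrite take0 big_nil.
have [nN|Nn] := ltnP n N; last first.
  apply: eq_fbdd IHn => p Dp.
  by rewrite !take_oversize// lam_size// ltnW.
have h : fbdd D id (fun p => w j + (- (lam j p)`_n) *: (1 : Cinf M)).
  apply: (@fbddD _ D id) => //.
  apply: (@fbddZ _ D id _ (fun p => - (lam j p)`_n) (fun=> 1) c) => //; last exact: fbdd1.
  by move=> p Dp; rewrite normrN; exact: nth_lam_bdd.
apply: eq_fbdd (fbddM _ IHn h) => // p Dp.
by rewrite (take_nth 0) ?lam_size// big_rcons/= -scaleNr mulrC.
Qed.

Lemma newtonS k j0 p : D p -> (k j0 < N)%N ->
  newton k p * (w j0 - (lam j0 p)`_(k j0) *: (1 : Cinf M)) =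
  newton (fun j => (k j + (j == j0))%N) p.
Proof.
move=> Dp kN; rewrite /newton (bigD1 j0)//= [RHS](bigD1 j0)//= eqxx addn1.
rewrite (take_nth 0) ?lam_size// big_rcons/= mulrAC; congr (_ * _).
by apply: eq_bigr => j /negPf ->; rewrite addn0.
Qed.

(** Once all N nodes of [w j0] are used up, the product contains the full factor annihilated by
    [lam0]. *)
Lemma newton0 k j0 p : D p -> (N <= k j0)%N -> Phi (newton k p) p = 0.
Proof.
move=> Dp Nk; rewrite /newton (bigD1 j0)//= take_oversize ?lam_size//.
by rewrite (mxalgM (Phi_alg Dp)) lam0// mul0mx.
Qed.

(** [Some j] keeps the function [w j], [None] puts a constant. The constants will be eigenvalues,
    which depend on the point, so they travel as parameters and bounds have to be uniform in
    them. *)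
Definition reduction_arg q (sg : 'I_q -> option 'I_m) (z : 'I_q -> R) (i : 'I_q) : Cinf M :=
  if sg i is Some j then w j else z i *: (1 : Cinf M).

Definition reduction_dom q : set (T * ('I_q -> R)) :=
  [set s | D s.1 /\ forall i, `|s.2 i| <= c].

(** With constant arguments only, G contributes a scalar, bounded because the arguments stay in a
    compact cube. *)
Lemma subst_const_bdd q (G : Cinf (euclid R q)) sg : (forall i, sg i = None) ->
  forall k, fbdd (@reduction_dom q) fst
    (fun s => newton k s.1 * cinf_subst G (reduction_arg sg s.2)).
Proof.
move=> sgN k.
have [C GC] : exists C : R, forall v : 'rV[R]_q, box 0 c v -> `|G v| <= C.
  pose Gf : 'rV[R]_q -> R := G.
  have cG : continuous Gf.
    by move=> v; apply: (smooth_on_continuous (euclid_smooth (cfunP G))).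
  have [C [_ H]] : bounded_set (Gf @` box 0 c).
    apply: compact_bounded; apply: continuous_compact; last exact: box_compact.
    exact: continuous_subspaceT.
  by exists (C + 1) => v vb; apply: (H _ (ltr_pwDr ltr01 (lexx _))); exists v.
have h : fbdd (@reduction_dom q) fst (fun s => G (\row_i s.2 i) *: newton k s.1).
  apply: (@fbddZ _ (@reduction_dom q) fst _ (fun s => G (\row_i s.2 i)) (fun s => newton k s.1) C).
  - by move=> s [].
  - by move=> s [_ sc]; apply: GC; apply/box_coord => i; rewrite !mxE subr0.
  - by apply: (fbdd_comp (Q := D) (g := fst)) (newton_bdd k) => s [].
apply: eq_fbdd h => s [Ds _].
have GE y : cinf_subst G (reduction_arg sg s.2) y = G (\row_i s.2 i).
  congr (cfun G _); apply/rowP => i; rewrite !mxE /reduction_arg sgN.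
  exact: mulr1.
apply: cinf_ext => y.
transitivity (newton k s.1 y * cinf_subst G (reduction_arg sg s.2) y) => //.
by rewrite GE mulrC.
Qed.

(* Hadamard's lemma gives [G(a) = G(a') + (w_j - l) H(a, a')] where [a'] is [a]
   with an argument [w_j] replaced by the next eigenvalue [l]: the first term has
   fewer non-constant arguments, the second one more Newton factor. *)
Lemma newton_subst_bdd k q (G : Cinf (euclid R q)) sg :
  fbdd (@reduction_dom q) fst (fun s => newton k s.1 * cinf_subst G (reduction_arg sg s.2)).
Proof.
(* The outer induction counts the Newton factors still missing, the inner one the non-constant
   arguments. The quotient [H i0] has 2q arguments and possibly more non-constant ones, so the outer
   hypothesis is general in q, G and [sg]. *)
have [K] := ubnP (\sum_j (N - k j)); elim: K k q G sg => // K IHK k q G sg.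
rewrite ltnS => kK; have [t] := ubnP (\sum_i isSome (sg i)).
elim: t q G sg => // t IHt q G sg; rewrite ltnS => sgt.
have [/forallP sgN|] := boolP [forall i, sg i == None].
  by apply: subst_const_bdd => i; exact/eqP.
rewrite negb_forall => /existsP[i0].
case sgi0 : (sg i0) => [j0|//] _.
have [Nk|kN] := leqP N (k j0).
  exists 0 => s [Ds _] i j.
  by rewrite (mxalgM (Phi_alg Ds)) (newton0 Ds Nk) mul0mx mxE normr0.
pose lk p := (lam j0 p)`_(k j0).
pose sg' i := if i == i0 then None else sg i.
pose z' (s : T * ('I_q -> R)) i := if i == i0 then lk s.1 else s.2 i.
have z'c s : reduction_dom s -> forall i, `|z' s i| <= c.
  move=> [Ds sc] i; rewrite /z'; case: eqP => _; last exact: sc.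
  exact: nth_lam_bdd.
have [H HE] := hadamard G.
pose sg2 (i : 'I_(q + q)) := match fintype.split i with inl i => sg i | inr i => sg' i end.
pose z2 s (i : 'I_(q + q)) := match fintype.split i with inl i => s.2 i | inr i => z' s i end.
have h1 : fbdd (@reduction_dom q) fst
    (fun s => newton k s.1 * cinf_subst G (reduction_arg sg' (z' s))).
  apply: (fbdd_comp (g := fun s => (s.1, z' s)) _ (IHt q G sg' _)).
    by move=> s Ds; split; [case: Ds|exact: z'c].
  apply: leq_trans sgt; rewrite (bigD1 i0)//= [ltnRHS](bigD1 i0)//= sgi0 /sg' eqxx.
  by rewrite add0n add1n ltnS; apply: leq_sum => i /negPf ->.
have h2 : fbdd (@reduction_dom q) fst (fun s => newton (fun j => (k j + (j == j0))%N) s.1 *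
    cinf_subst (H i0) (reduction_arg sg2 (z2 s))).
  apply: (fbdd_comp (g := fun s => (s.1, z2 s)) _ (IHK _ _ (H i0) sg2 _)).
    move=> s Ds; split=> [|i]; first by case: Ds.
    by rewrite /= /z2; case: fintype.split => i'; [case: Ds => _; apply|exact: z'c].
  apply: leq_trans kK; rewrite (bigD1 j0)//= [ltnRHS](bigD1 j0)//= eqxx addn1 -addSn.
  apply: leq_add; first by rewrite subnSK.
  by apply: leq_sum => j /negPf ->; rewrite addn0.
apply: eq_fbdd (fbddD _ h1 h2) => [s [Ds sc]|s []//].
rewrite -newtonS// -mulrA -mulrDr; congr (_ * _); apply/esym/cinf_ext => y /=.
transitivity (G (\row_i reduction_arg sg' (z' s) i y) + (w j0 y - lk s.1 * 1) *
    H i0 (\row_i reduction_arg sg2 (z2 s) i y)) => //.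
rewrite (HE _ (\row_i reduction_arg sg' (z' s) i y)) mulr1; congr (_ + _).
(* Both argument lists agree away from [i0], so a single Hadamard term survives. *)
rewrite (bigD1 i0)//= big1 ?addr0 => [|i ii0]; last first.
  rewrite !mxE /reduction_arg /sg' /z' (negPf ii0).
  by rewrite subrr mul0r.
rewrite !mxE /reduction_arg /sg' /z' eqxx sgi0; congr ((_ - _) * cfun (H i0) _).
  exact: mulr1.
apply/rowP => i; rewrite !mxE /sg2 /z2.
by case: fintype.split => i'; rewrite !mxE.
Qed.

Lemma subst_bdd q (G : Cinf (euclid R q)) sg :
  fbdd (@reduction_dom q) fst (fun s => cinf_subst G (reduction_arg sg s.2)).
Proof.
apply: eq_fbdd (newton_subst_bdd (fun=> 0%N) G sg) => s _.
by rewrite /newton big1 ?mul1r// => j _; rewrite take0 big_nil.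
Qed.

End PolynomialReduction.

(** * Smooth families of functions *)

Section SmoothFamilies.
Variables (R : realType) (M : premanifold R) (n : nat).
Implicit Types (V : set 'rV[R]_n) (F : 'rV[R]_n -> M -> R).

Definition family_domain V (d : chart R M (pdim M)) : set 'rV[R]_(n + pdim M) :=
  [set z | V (lsubmx z) /\ (cmap d @` cdom d) (rsubmx z)].

Definition smooth_family V F : Prop := forall d, patlas d ->
  smooth_on (family_domain V d) (fun z => F (lsubmx z) (cinv d (rsubmx z))).

Lemma family_domain_open V d : open V -> open (family_domain V d).
Proof.
move=> oV; apply: openI; apply: open_comp => //.
- by move=> z _; exact: continuous_lsubmx.
- by move=> z _; exact: continuous_rsubmx.
- exact: cimg_open.
Qed.

Lemma smooth_familyS V W F : W `<=` V -> smooth_family V F -> smooth_family W F.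
Proof. by move=> WV FV d Ad; apply: smooth_onS (FV d Ad) => z [/WV]. Qed.

Lemma family_slice V F p : open V -> smooth_family V F -> V p -> msmooth (F p).
Proof.
move=> oV FV Vp d Ad; rewrite setIT.
have H : smooth_on (cmap d @` cdom d)
    ((fun z => F (lsubmx z) (cinv d (rsubmx z))) \o (fun q => row_mx p q)).
  apply: smooth_on_comp (FV d Ad) _ => [|||j]; first exact: cimg_open.
  - exact: family_domain_open.
  - by move=> q dq; split; rewrite ?row_mxKl ?row_mxKr.
  - rewrite -(splitK j); case: (fintype.split j) => i /=.
      apply: smooth_on_ext (smooth_on_cst _ (p 0 i)); first exact: cimg_open.
      by move=> q _; rewrite row_mxEl.
    apply: smooth_on_ext (@smooth_on_coord _ _ _ i); first exact: cimg_open.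
    by move=> q _; rewrite row_mxEr.
apply: smooth_on_ext H; first exact: cimg_open.
by move=> q _; rewrite /= row_mxKl row_mxKr.
Qed.

Lemma family_at V F y : open V -> smooth_family V F -> smooth_on V (F^~ y).
Proof.
move=> oV FV; have [d Ad dy] := patlas_cover y.
have H : smooth_on V ((fun z => F (lsubmx z) (cinv d (rsubmx z))) \o
    (fun p => row_mx p (cmap d y))).
  apply: smooth_on_comp (FV d Ad) _ => [//|||j]; first exact: family_domain_open.
  - by move=> p Vp; split; rewrite ?row_mxKl ?row_mxKr//; exists y.
  - rewrite -(splitK j); case: (fintype.split j) => i /=.
      apply: smooth_on_ext (@smooth_on_coord _ _ _ i) => // q _.
      by rewrite row_mxEl.
    apply: smooth_on_ext (smooth_on_cst _ (cmap d y 0 i)) => // q _.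
    by rewrite row_mxEr.
by apply: smooth_on_ext H => // q _; rewrite /= row_mxKl row_mxKr cmapK ?inE.
Qed.

Lemma family_derive V F i : open V -> smooth_family V F ->
  smooth_family V (fun p y => 'D_(delta_mx 0 i) (F^~ y) p).
Proof.
move=> oV FV d Ad.
apply: smooth_on_ext (smooth_on_derive (lshift (pdim M) i) (FV d Ad)).
  exact: family_domain_open.
move=> z _.
have [|->//] := @derive_reparam _ _ _ (fun z => F (lsubmx z) (cinv d (rsubmx z)))
  (F^~ (cinv d (rsubmx z))) z (lsubmx z) (delta_mx 0 (lshift (pdim M) i)) (delta_mx 0 i).
move=> h; congr (F _ (cinv d _)); apply/rowP => j; rewrite !mxE.
  by rewrite (inj_eq (@lshift_inj _ _)).
by rewrite eq_rlshift andbF mulr0 add0r.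
Qed.

Lemma family_segment V F p0 : open V ->
  (forall p s, V p -> s \in `[0, 1] -> V (p0 + s *: (p - p0))) -> smooth_family V F ->
  smooth_family V (fun p y => int01 (fun t => F (p0 + t *: (p - p0)) y)).
Proof.
move=> oV sV FV d Ad.
(* In the layout (t, (p, q)), the point (p0 + t (p - p0), q) at which F is read in the chart. *)
pose c (x : 'rV[R]_(1 + (n + pdim M))) : 'rV[R]_(n + pdim M) :=
  row_mx (p0 + lsubmx x 0 0 *: (lsubmx (rsubmx x) - p0)) (rsubmx (rsubmx x)).
have cs j : smooth_on setT (fun x => c x 0 j).
  have oT := @openT 'rV[R]_(1 + (n + pdim M)).
  rewrite -(splitK j); case: (fintype.split j) => i /=.
    rewrite (_ : (fun _ => _) = fun x : 'rV[R]_(1 + (n + pdim M)) =>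
       p0 0 i + x 0 (lshift (n + pdim M) 0) *
         (x 0 (rshift 1 (lshift (pdim M) i)) - p0 0 i)); last first.
      by apply/funext => x; rewrite row_mxEl !mxE.
    apply: smooth_on_add => //; first exact: smooth_on_cst.
    apply: smooth_on_mul => //; first exact: smooth_on_coord.
    by apply: smooth_on_sub => //; [exact: smooth_on_coord|exact: smooth_on_cst].
  apply: smooth_on_ext (@smooth_on_coord _ _ _ (rshift 1 (rshift n i))) => // x _.
  by rewrite row_mxEr !mxE.
have cc : continuous c.
  by move=> x; apply: continuous_row => j; exact: (smooth_on_continuous (cs j)).
pose Om := c @^-1` family_domain V d.
have oOm : open Om by apply: open_comp; [move=> x _; exact: cc|exact: family_domain_open].
have H : smooth_on (family_domain V d) (pint ((fun z => F (lsubmx z) (cinv d (rsubmx z))) \o c)).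
  apply: (@smooth_on_pint _ _ Om) => //; first exact: family_domain_open.
    move=> t z t01 [Vz dz]; rewrite /Om /c; split; rewrite /= ?row_mxKl ?row_mxKr//.
    by rewrite mxE; exact: sV.
  apply: (@smooth_on_comp _ _ _ Om (family_domain V d) _ c) => //; first exact: family_domain_open.
    exact: FV.
  by move=> j; apply: smooth_onS (cs j).
apply: smooth_on_ext H; first exact: family_domain_open.
move=> z _; apply: eq_int01 => t _ /=.
by rewrite /c row_mxKl row_mxKr !row_mxKr !row_mxKl mxE.
Qed.

Lemma family_hadamard V F p0 : open V -> V p0 ->
  (forall p s, V p -> s \in `[0, 1] -> V (p0 + s *: (p - p0))) -> smooth_family V F ->
  exists Q : 'I_n -> 'rV[R]_n -> M -> R, [/\ forall i, smooth_family V (Q i),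
    forall p y, V p -> F p y = F p0 y + \sum_i (p 0 i - p0 0 i) * Q i p y &
    forall i y, Q i p0 y = 'D_(delta_mx 0 i) (F^~ y) p0].
Proof.
move=> oV Vp0 sV FV.
exists (fun i p y => int01 (fun t => 'D_(delta_mx 0 i) (F^~ y) (p0 + t *: (p - p0)))).
split=> [i|p y Vp|i y].
- exact: (family_segment oV sV (family_derive i oV FV)).
- have E := @hadamard_seg _ _ V (F^~ y) p0 (p - p0) (@family_at V F y oV FV 2) (fun s => sV p s Vp).
  have pE : F (p0 + (p - p0)) y = F p y by congr (F _ y); rewrite addrC subrK.
  apply: etrans (etrans (esym pE) E) _.
  apply: (congr1 (fun s => F p0 y + s)); apply: eq_bigr => i _; by rewrite 2!mxE.
- rewrite -[RHS]int01_cst; apply: eq_int01 => t _.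
  by rewrite subrr scaler0 addr0.
Qed.

(** A non-smooth f is sent to 0, so that a family needs no smoothness proof for each parameter;
    inside the domain V the slices are smooth and [to_CinfE] applies. *)
Definition to_Cinf (f : M -> R) : Cinf M := insubd 0 f.

Lemma to_CinfE f : msmooth f -> to_Cinf f = f :> (M -> R).
Proof. by move=> fs; apply: (insubdK (0 : Cinf M)); exact/asboolP. Qed.

End SmoothFamilies.

(** * Local boundedness *)

Section Compress.
Variable R : realType.

(* Maps the whole line smoothly onto [-1/2, 1/2]: this turns functions smooth
   near a cube into functions smooth on the whole space. *)
Definition compress (q : R) : R := q / (1 + q ^+ 2).

Lemma compress_den q : 0 < 1 + q ^+ 2 :> R.
Proof. by rewrite ltr_pwDl// sqr_ge0. Qed.

Lemma compress_bound q : `|compress q| <= 1 / 2.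
Proof.
rewrite ler_norml /compress ler_pdivlMr ?compress_den// ler_pdivrMr ?compress_den//.
by apply/andP; split; have := sqr_ge0 (q + 1); have := sqr_ge0 (q - 1); nra.
Qed.

Lemma compress_surj t : `|t| <= 1 / 2 -> exists2 q, `|q| <= 1 & compress q = t.
Proof.
rewrite ler_norml => /andP[t1 t2].
have d0 : 0 <= 1 - 4 * t ^+ 2 by nra.
pose s := Num.sqrt (1 - 4 * t ^+ 2).
have s0 : 0 <= s by exact: sqrtr_ge0.
have sE : s ^+ 2 = 1 - 4 * t ^+ 2 by rewrite sqr_sqrtr.
have s1 : 0 < 1 + s by rewrite ltr_pwDl.
have sn : 1 + s != 0 by rewrite gt_eqF.
(* The small root (1 - s) / (2t) of t q^2 - q + t = 0, rationalised so that t = 0 is no exception;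
   |q| <= 1 because |2t| <= 1 <= 1 + s. *)
exists (2 * t / (1 + s)).
  rewrite ler_norml ler_pdivlMr// ler_pdivrMr//; apply/andP; split; nra.
rewrite /compress.
have E : 1 + (2 * t / (1 + s)) ^+ 2 = 2 / (1 + s).
  have -> : (2 * t / (1 + s)) ^+ 2 = (4 * t ^+ 2) / (1 + s) ^+ 2 by field.
  have -> : 4 * t ^+ 2 = 1 - s ^+ 2 by rewrite sE; ring.
  by field.
by rewrite E; field; rewrite sn.
Qed.

Lemma compress_smooth n (i : 'I_n) : smooth_on setT (fun v : 'rV[R]_n => compress (v 0 i)).
Proof.
have oT := @openT 'rV[R]_n.
apply: smooth_on_mul => //; first exact: smooth_on_coord.
apply: smooth_on_inv => //; first by move=> v _; rewrite gt_eqF ?compress_den.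
apply: smooth_on_add => //; first exact: smooth_on_cst.
by apply: smooth_on_mul => //; exact: smooth_on_coord.
Qed.

End Compress.

Section LocalBound.
Variables (R : realType) (M : manifold R) (n N : nat) (V : set 'rV[R]_n).

Definition smooth_mxalg (K : nat) (Phi : Cinf M -> 'rV[R]_n -> 'M[R]_K) : Prop :=
  (forall p, V p -> mxalg (Phi^~ p)) /\
  (forall f i j, smooth_on V (fun p => Phi f p i j)).

Hypothesis oV : open V.
Variable Phi : Cinf M -> 'rV[R]_n -> 'M[R]_N.
Hypothesis Phi_alg : smooth_mxalg Phi.
Variable p0 : 'rV[R]_n.
Hypothesis Vp0 : V p0.

Definition locbdd (F : 'rV[R]_n -> Cinf M) : Prop :=
  exists C : R, \forall p \near p0, forall i j, `|Phi (F p) p i j| <= C.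

Let Vn : \forall p \near p0, V p.
Proof. exact: open_nbhs_nbhs. Qed.

Lemma entry_continuous f i j : {for p0, continuous (fun p => Phi f p i j)}.
Proof. exact: smooth_on_continuous (Phi_alg.2 f i j) Vp0. Qed.

Lemma locbdd_cst f : locbdd (fun=> f).
Proof.
exists (`|Phi f p0| + 1).
apply: (@filter_forall _ _ (fun i p => forall j, `|Phi f p i j| <= `|Phi f p0| + 1) (nbhs p0)) => i.
apply: (@filter_forall _ _ (fun j p => `|Phi f p i j| <= `|Phi f p0| + 1) (nbhs p0)) => j.
have /cvgrPdist_le/(_ _ ltr01) := @entry_continuous f i j.
apply: filterS => p pd; rewrite -(subrK (Phi f p0 i j) (Phi f p i j)).
apply: le_trans (ler_normD _ _) _; rewrite addrC; apply: lerD; last by rewrite distrC.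
rewrite [leRHS]mx_normrE.
by rewrite (le_trans _ (le_bigmax _ (fun ij => `|Phi f p0 ij.1 ij.2|) (i, j))).
Qed.

Lemma locbddD F G : locbdd F -> locbdd G -> locbdd (fun p => F p + G p).
Proof.
move=> [B FB] [C GC]; exists (B + C); apply: filterS3 Vn FB GC => p Vp FB GC i j.
rewrite (mxalgD (Phi_alg.1 p Vp)) mxE; apply: le_trans (ler_normD _ _) _.
by apply: lerD; [exact: FB|exact: GC].
Qed.

Lemma locbddM F G : locbdd F -> locbdd G -> locbdd (fun p => F p * G p).
Proof.
move=> [B FB] [C GC]; exists (\sum_(k < N) B * C); apply: filterS3 Vn FB GC => p Vp FB GC i j.
rewrite (mxalgM (Phi_alg.1 p Vp)) mxE; apply: le_trans (ler_norm_sum _ _ _) _.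
by apply: ler_sum => k _; rewrite normrM; apply: ler_pM.
Qed.

Lemma eq_locbdd F G : (\forall p \near p0, Phi (F p) p = Phi (G p) p) ->
  locbdd F -> locbdd G.
Proof. by move=> E [C FC]; exists C; apply: filterS2 E FC => p <-. Qed.

Lemma unitmx_near f : Phi f p0 \in unitmx -> \forall p \near p0, Phi f p \in unitmx.
Proof.
rewrite unitmxE unitfE => d0.
have cd : {for p0, continuous (fun p => \det (Phi f p))}.
  have Fp := nbhs_filter p0.
  have -> : (fun p => \det (Phi f p)) =
      (fun p => \sum_(s : {perm 'I_N}) (-1) ^+ s * \prod_i Phi f p i (s i)) by [].
  apply: (cvg_sum_fin Fp) => s.
  apply: cvgM; first exact: cvg_cst.
  apply: (cvg_prod_fin Fp) => i.
  exact: entry_continuous.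
have H : \forall p \near p0, \det (Phi f p) != 0 by exact: cvgr_neq0 cd d0.
by apply: filterS H => p; rewrite unitmxE unitfE.
Qed.

(* [Phi f p] only depends on [f] over a compact set, locally uniformly in [p]. *)
Lemma cutoff : exists2 th : Cinf M, \forall p \near p0, Phi th p = 1%:M &
  exists2 K : set M, compact K & forall y, ~ K y -> th y = 0.
Proof.
have [rho rhoK] := cinf_proper M.
have [s [_ _ s0]] := mxalg_split rho (Phi_alg.1 p0 Vp0).
pose c := \sum_(l <- s) `|l|.
have sc l : l \in s -> l <= c.
  move=> ls; apply: le_trans (ler_norm l) _.
  by rewrite /c (big_rem l)//= lerDl sumr_ge0.
have crho a : closed [set y | rho y <= a].
  by apply: compact_closed; [exact: m_hausdorff|exact: rhoK].
have orho a : open [set y | rho y < a].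
  rewrite (_ : [set y | _] = rho @^-1` [set x | x < a])//.
  apply: open_comp; last exact: open_lt.
  by move=> y _; exact: (msmooth_continuous (cfunP rho)).
have lt1 a : [set y | rho y <= a] `<=` [set y | rho y < a + 1].
  by move=> y /= /le_lt_trans; apply; rewrite ltrDl.
have [th [th1 ths]] := cinf_urysohn (crho c) (orho (c + 1)) (@lt1 c).
have [th' [th'1 th's]] := cinf_urysohn (crho (c + 1)) (orho (c + 1 + 1)) (@lt1 (c + 1)).
exists th'; last first.
  exists [set y | rho y <= c + 1 + 1]; first exact: rhoK.
  move=> y /= ny; apply/eqP/negPn/negP => h; apply: ny.
  by apply/ltW/th's; exact: subset_closure.
have thth' : th' * th = th.
  apply: cinf_ext => y; transitivity (th' y * th y) => //.
  have [->|ty] := eqVneq (th y) 0; first by rewrite mulr0.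
  rewrite th'1 ?mul1r//; apply/ltW/ths; exact: subset_closure.
pose P := \prod_(l <- s) (rho - l *: (1 : Cinf M)).
have Pe y : P y = \prod_(l <- s) (rho y - l).
  rewrite /P (@big_morph _ _ (fun f : Cinf M => f y) 1 *%R 1 *%R)//.
  by apply: eq_bigr => l _; transitivity (rho y - l * 1) => //; rewrite mulr1.
(* The zeros of P lie where [rho] is an eigenvalue, hence at most c, and there [th] is 1: the sum of
   squares vanishes nowhere. As P is killed at p0, this makes [Phi th] invertible at p0, then
   nearby, and [th' * th = th] forces [Phi th'] to be the identity. *)
have ku : Phi (P * P + th * th) p0 \in unitmx.
  apply: (mxalg_unit (Phi_alg.1 p0 Vp0)) => y.
  have -> : (P * P + th * th) y = P y * P y + th y * th y by [].
  rewrite -!expr2 paddr_eq0 ?sqr_ge0// !sqrf_eq0 negb_and -implybE.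
  apply/implyP => /eqP P0; rewrite th1 ?oner_eq0//.
  have : \prod_(l <- s) (rho y - l) == 0 by rewrite -Pe P0.
  by rewrite prodf_seq_eq0 => /hasP[l ls /=]; rewrite subr_eq0 => /eqP ->; exact: sc.
have ca0 := Phi_alg.1 p0 Vp0.
have : Phi th p0 \in unitmx.
  move: ku; rewrite (mxalgD ca0) !(mxalgM ca0) s0 mul0mx add0r unitmx_mul.
  by case/andP.
move=> /unitmx_near; apply: filterS2 Vn => p Vp tu.
have := mxalgM (Phi_alg.1 p Vp) th' th; rewrite thth' => E.
by rewrite -(mulmxK tu (Phi th' p)) -E mulmxV.
Qed.

End LocalBound.

Lemma smooth_on_compress_dom (R : realType) n (p0 : 'rV[R]_n) (e : R) i m :
  smooth_on setT (fun z : 'rV[R]_(n + m) => p0 0 i + e * compress (lsubmx z 0 i)).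
Proof.
have oT := @openT 'rV[R]_(n + m).
apply: smooth_on_add => //; first exact: smooth_on_cst.
apply: smooth_on_mul => //; first exact: smooth_on_cst.
apply: (smooth_on_ext oT _ (@compress_smooth R (n + m) (lshift m i))) => z _.
by rewrite mxE.
Qed.

(** * Bounding a smooth family near a parameter, first over a chart and then globally *)

Section FamilyBound.
Variables (R : realType) (M : manifold R) (n N : nat) (V : set 'rV[R]_n).
Hypothesis oV : open V.
Variable Phi : Cinf M -> 'rV[R]_n -> 'M[R]_N.
Hypothesis Phi_alg : smooth_mxalg V Phi.
Variable F : 'rV[R]_n -> M -> R.
Hypothesis FV : smooth_family V F.
Variable p0 : 'rV[R]_n.
Hypothesis Vp0 : V p0.

Section Bump.
Variables (d : chart R M (pdim M)) (Ad : patlas d).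
Variables (psi : Cinf M) (B : set 'rV[R]_(pdim M)).
Hypotheses (cB : compact B) (Bd : B `<=` cmap d @` cdom d).
Hypothesis psiB : forall y, psi y != 0 -> B (cmap d y).
Hypothesis psid : closure [set y | psi y != 0] `<=` cdom d.

Let psi0 y : psi y != 0 -> cdom d y.
Proof. by move=> h; apply: psid; exact: subset_closure. Qed.

Lemma cutoff_coord_smooth j :
  (fun y => psi y * cmap d y 0 j) \in msmooth_pred (M := M).
Proof.
apply/asboolP/msmooth_local => y.
have [dy|ndy] := pselect (cdom d y).
  exists (cdom d); split=> //; first exact: cdom_open.
  apply: (msmooth_onM (@cdom_open _ _ _ d)); last exact: msmooth_chart.
  by apply: msmooth_onS (cfunP psi).
exists (~` closure [set y | psi y != 0]); split.
- by apply: closed_openC; exact: closed_closure.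
- by move=> /psid.
apply: msmooth_on_ext (msmooth_on_cst _ 0).
- by apply: closed_openC; exact: closed_closure.
- move=> z nz; have [->|h] := eqVneq (psi z) 0; first by rewrite mul0r.
  by case: nz; exact: subset_closure.
Qed.

Definition cutoff_coord j : Cinf M := MkCinf (cutoff_coord_smooth j).

Lemma cutoff_coord_bounded : exists C : R, forall j y, `|cutoff_coord j y| <= C.
Proof.
have cK : compact (cinv d @` B).
  apply: continuous_compact => //; apply: continuous_in_subspaceT => v.
  by rewrite inE => /Bd dv; apply: cinv_continuous; rewrite inE.
have H j : exists C : R, forall y, `|cutoff_coord j y| <= C.
  have [C [_ CH]] : bounded_set (cutoff_coord j @` (cinv d @` B)).
    apply: compact_bounded; apply: continuous_compact => //.
    apply: continuous_subspaceT => y.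
    exact: (msmooth_continuous (cfunP (cutoff_coord j))).
  exists (`|C| + 1) => y; have [p0'|pn] := eqVneq (psi y) 0.
    by rewrite /= p0' mul0r normr0 addr_ge0.
  apply: (CH (`|C| + 1)).
    by apply: le_lt_trans (ler_norm C) _; rewrite ltrDl.
  exists y => //; exists (cmap d y); first exact: psiB.
  by rewrite cmapK// inE; exact: psi0.
have [C CH] := choice H; exists (\sum_j `|C j|) => j y.
apply: le_trans (CH j y) _; apply: le_trans (ler_norm _) _.
by rewrite (bigD1 j)//= lerDl sumr_ge0.
Qed.

Variable e : R.
Hypothesis eV : box p0 (e / 2) `<=` V.
Hypothesis e0 : 0 < e.

(** Maps R^n onto the cube of half-side e/2 about p0, the 1/2 being the bound of [compress];
    composing with it makes the family defined and smooth for all parameters. *)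
Let tau (q : 'rV[R]_n) : 'rV[R]_n := \row_i (p0 0 i + e * compress (q 0 i)).

Let tauV q : V (tau q).
Proof.
apply/eV/box_coord => i; rewrite mxE addrAC subrr add0r normrM gtr0_norm//.
apply: ler_wpM2l; first exact: ltW.
by rewrite -[leRHS]mul1r; exact: compress_bound.
Qed.

(* On the support of a bump where [psi = 1], a family over [M] is the composite of
   [G], which is smooth everywhere, with the cut off coordinates. *)
Let G (z : 'rV[R]_(n + pdim M)) : R :=
  if `[< (cmap d @` cdom d) (rsubmx z) >]
  then F (tau (lsubmx z)) (cinv d (rsubmx z)) * psi (cinv d (rsubmx z)) else 0.

(** Two open sets suffice: the cylinder over the chart image, where G is a product of smooth
    functions, and the complement of the cylinder over the compact set B, where [psi] makes G
    vanish. *)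
Lemma extension_smooth : G \in msmooth_pred (M := euclid R (n + pdim M)).
Proof.
apply/asboolP/msmooth_euclid/smooth_on_local => z _.
have [dz|ndz] := pselect ((cmap d @` cdom d) (rsubmx z)).
  pose W : set 'rV[R]_(n + pdim M) := rsubmx @^-1` (cmap d @` cdom d).
  have oW : open W.
    apply: open_comp; last exact: cimg_open.
    by move=> x _; exact: continuous_rsubmx.
  exists W; split=> //.
  pose c (x : 'rV[R]_(n + pdim M)) := row_mx (tau (lsubmx x)) (rsubmx x).
  have cs j : smooth_on W (fun x => c x 0 j).
    rewrite -(splitK j); case: (fintype.split j) => i /=.
      have h := smooth_onS (@subsetT _ W) (@smooth_on_compress_dom R n p0 e i (pdim M)).
      apply: (smooth_on_ext oW _ h) => x _.
      by rewrite row_mxEl !mxE.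
    apply: smooth_on_ext (@smooth_on_coord _ _ _ (rshift n i)) => // x _.
    by rewrite row_mxEr mxE.
  have H1 : smooth_on W ((fun z => F (lsubmx z) (cinv d (rsubmx z))) \o c).
    apply: (@smooth_on_comp _ _ _ W (family_domain V d)) => //; first exact: family_domain_open.
      move=> x Wx; split; first by rewrite row_mxKl; exact: tauV.
      by rewrite row_mxKr.
    exact: FV.
  have H2 : smooth_on W (fun x => psi (cinv d (rsubmx x))).
    apply: (@smooth_on_rsubmx _ _ _ (cmap d @` cdom d) W (psi \o cinv d)) => //.
      exact: cimg_open.
    by have := cfunP psi Ad; rewrite setIT.
  apply: smooth_on_ext (smooth_on_mul oW H1 H2) => // x Wx.
  by rewrite /G asboolT//= /c row_mxKl row_mxKr.
exists (~` (rsubmx @^-1` B)); split.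
- apply: closed_openC; apply: preimage_closed.
    by move=> x _; exact: continuous_rsubmx.
  by apply: compact_closed => //; exact: norm_hausdorff.
- by move=> /Bd.
apply: smooth_on_ext (smooth_on_cst _ 0).
- apply: closed_openC; apply: preimage_closed.
    by move=> x _; exact: continuous_rsubmx.
  by apply: compact_closed => //; exact: norm_hausdorff.
- move=> x nBx; rewrite /G; case: asboolP => // -[y dy yx].
  have [->|h] := eqVneq (psi (cinv d (rsubmx x))) 0; first by rewrite mulr0.
  case: nBx; rewrite /preimage /= -yx; move: h.
  by rewrite -yx cmapK ?inE//; exact: psiB.
Qed.

Let sg (i : 'I_(n + pdim M)) : option 'I_(pdim M) :=
  match fintype.split i with inl _ => None | inr j => Some j end.

Lemma extension_subst (eta : Cinf M) (q : 'rV[R]_n) :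
  (forall y, eta y != 0 -> psi y = 1) ->
  eta * to_Cinf (F (tau q)) = eta * cinf_subst (MkCinf extension_smooth)
    (reduction_arg cutoff_coord sg (fun i => match fintype.split i with inl j => q 0 j | inr _ => 0 end)).
Proof.
move=> eta1; apply: cinf_ext => y.
pose a := reduction_arg cutoff_coord sg (fun i => match fintype.split i with inl j => q 0 j | inr _ => 0 end).
transitivity (eta y * to_Cinf (F (tau q)) y) => //.
transitivity (eta y * G (\row_i a i y)) => //.
have [->|en] := eqVneq (eta y) 0; first by rewrite !mul0r.
congr (_ * _); have p1 := eta1 y en.
have dy : cdom d y by apply: psi0; rewrite p1 oner_eq0.
have -> : \row_i a i y = row_mx q (cmap d y).
  apply/rowP => i; rewrite !mxE /a /reduction_arg /sg.
  case: fintype.split => j; first exact: mulr1.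
  by rewrite /= p1 mul1r.
rewrite /G row_mxKl row_mxKr asboolT; last by exists y.
rewrite cmapK ?inE// p1 mulr1 to_CinfE//.
exact: family_slice oV FV (tauV q).
Qed.

(** Each p near p0 is [tau q] for some q, chosen without any continuity in p; since q enters only as
    bounded constants, the uniform bound of [subst_bdd] is enough. *)
Lemma bump_locbdd (eta : Cinf M) : (forall y, eta y != 0 -> psi y = 1) ->
  locbdd Phi p0 (fun p => eta * to_Cinf (F p)).
Proof.
move=> eta1; have [c0 wc0] := cutoff_coord_bounded.
(* Bounds the eigenvalues, which are values of cut off coordinates, by c0, and the parameters q
   given by [compress_surj] by 1. *)
pose c := Num.max 1 c0.
have wc j y : `|cutoff_coord j y| <= c.
  by apply: le_trans (wc0 j y) _; rewrite le_max lexx orbT.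
have Wb j := locbdd_cst Phi_alg Vp0 (cutoff_coord j).
have [C CH] := choice Wb.
pose D := V `&` [set p | forall j i k, `|Phi (cutoff_coord j) p i k| <= C j].
have Dn : \forall p \near p0, D p.
  apply: filterI; first exact: open_nbhs_nbhs.
  by apply: (@filter_forall _ _ (fun j p => forall i k, `|Phi (cutoff_coord j) p i k| <= C j) (nbhs p0)).
have Da p : D p -> mxalg (Phi^~ p) by move=> [Vp _]; exact: Phi_alg.1.
have lamex j : exists s : 'rV[R]_n -> seq R, forall p, D p -> [/\ size (s p) = N,
    forall l, l \in s p -> exists y, cutoff_coord j y = l &
    Phi (\prod_(l <- s p) (cutoff_coord j - l *: (1 : Cinf M))) p = 0].
  have H p : exists s, D p -> [/\ size s = N,
      forall l, l \in s -> exists y, cutoff_coord j y = l &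
      Phi (\prod_(l <- s) (cutoff_coord j - l *: (1 : Cinf M))) p = 0].
    have [Dp|nD] := pselect (D p); last by exists [::].
    by have [s sH] := mxalg_split (cutoff_coord j) (Da p Dp); exists s.
  by have [s sH] := choice H; exists s.
have [lam lamH] := choice lamex.
have [||||K KH] := @subst_bdd _ _ _ _ D Phi Da _ cutoff_coord c _ lam _ _ _ _
  (MkCinf extension_smooth) sg.
- by move=> j; exists (C j) => p [_]; apply.
- by move=> j p /(lamH j)[].
- by move=> j p l /(lamH j)[_ H _] /H[y <-].
- by move=> j p /(lamH j)[].
have [Ce eH] := locbdd_cst Phi_alg Vp0 eta.
exists (\sum_(k < N) Ce * K).
have bn : \forall p \near p0, box p0 (e / 2) p.
  have : \forall p \near p0, ball p0 (e / 2) p by apply: nbhsx_ballx; rewrite divr_gt0.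
  by apply: filterS; exact: ball_box.
apply: filterS3 Dn eH bn => p Dp eHp /box_coord bp i j.
have H k : exists q, `|q| <= 1 /\ compress q = (p 0 k - p0 0 k) / e.
  have [|q q1 qE] := @compress_surj _ ((p 0 k - p0 0 k) / e); last by exists q.
  rewrite normrM normfV (gtr0_norm e0) ler_pdivrMr//; have := bp k; lra.
have [q qH] := choice H.
have tq : tau (\row_k q k) = p.
  apply/rowP => k; rewrite !mxE (qH k).2 mulrCA mulfV ?gt_eqF// mulr1.
  by rewrite addrC subrK.
rewrite -{1}tq (extension_subst _ eta1) (mxalgM (Da p Dp)) mxE.
apply: le_trans (ler_norm_sum _ _ _) _; apply: ler_sum => k _.
rewrite normrM; apply: ler_pM => //.
apply: (KH (p, _)); split=> //= l.
case: fintype.split => k'; last by rewrite normr0 le_max ler01.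
by rewrite mxE; apply: le_trans (qH k').1 _; rewrite le_max lexx.
Qed.

End Bump.

(** The bounds over charts are added up over the compact set K of [cutoff]. As kap > 0 on K and th =
    0 off K, kap + (1 - th)^2 has an inverse g; where [Phi th] is the identity the second summand
    disappears, so F can be recovered from kap F by multiplying with the fixed g. *)
Lemma family_locbdd : locbdd Phi p0 (fun p => to_Cinf (F p)).
Proof.
have oVn : \forall p \near p0, V p by exact: open_nbhs_nbhs.
have [th th1 [K cK Kth]] := cutoff oV Phi_alg Vp0.
pose B : set (Cinf M) := [set f : Cinf M | (forall x, 0 <= f x) /\
  locbdd Phi p0 (fun p => f * to_Cinf (F p))].
have [||||kap [kap_ge kapB] kap0] := @cinf_cover _ M K B cK.
- split=> //; exists 0; apply: filterS oVn => p Vp i j.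
  by rewrite mul0r (mxalg0 (Phi_alg.1 p Vp)) mxE normr0.
- move=> f g [f0 fB] [g0 gB]; split=> [x|]; first exact: (addr_ge0 (f0 x) (g0 x)).
  apply: eq_locbdd (locbddD oV Phi_alg Vp0 fB gB).
  by apply: filterS oVn => p _; rewrite mulrDl.
- by move=> f x [].
- move=> y _; have [d Ad dy] := patlas_cover y.
  have [eta [psi [S [cS Sd psiS psid [ey eta1]]]]] := cinf_chart_bump Ad dy.
  have [e e0 eV] : exists2 e : R, 0 < e & ball p0 e `<=` V.
    by apply/nbhs_ballP; exact: open_nbhs_nbhs.
  (* Squared to be nonnegative, as [cinf_cover] demands. *)
  exists (eta * eta).
    split=> [x|]; first exact: sqr_ge0.
    have := @bump_locbdd d Ad psi S cS Sd psiS psid e _ e0 eta eta1.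
    move=> /(_ _)/(locbddM oV Phi_alg Vp0 (locbdd_cst Phi_alg Vp0 eta)) H.
    apply: eq_locbdd (H _); first by apply: filterS oVn => p _; rewrite mulrA.
    apply: subset_trans eV; apply: box_ball; first by rewrite divr_ge0 ?ltW.
    by rewrite ltr_pdivrMr// ltr_pMr// ltr1n.
  by have : 0 < eta y ^+ 2 by rewrite exprn_even_gt0.
have [g gu] : exists g, (kap + (1 - th) * (1 - th)) * g = 1.
  apply: cinf_unit => y.
  have -> : (kap + (1 - th) * (1 - th)) y = kap y + (1 - th y) ^+ 2 by rewrite expr2.
  have [Ky|nK] := pselect (K y).
    by rewrite gt_eqF// ltr_pwDl ?sqr_ge0// kap0.
  rewrite Kth// subr0 expr1n gt_eqF// ltr_wpDl//.
apply: eq_locbdd (locbddM oV Phi_alg Vp0 (locbdd_cst Phi_alg Vp0 g) kapB).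
apply: filterS2 oVn th1 => p Vp thp.
have ca := Phi_alg.1 p Vp.
rewrite -[in RHS](mul1r (to_Cinf (F p))) -gu.
rewrite !(mxalgM ca) !(mxalgD ca) (mxalgM ca) (mxalgB ca) (mxalg1 ca) thp subrr mulmx0 addr0.
by rewrite mulmxA [Phi g p *m _](mxalgC ca).
Qed.

End FamilyBound.

(** * Smoothness *)

Lemma cvg_mul_bounded (R : realType) (T : Type) (F : set_system T) (a u : T -> R) C :
  Filter F -> a @ F --> 0 -> (\forall x \near F, `|u x| <= C) ->
  (fun x => a x * u x) @ F --> 0.
Proof.
move=> FF a0 uC; apply/cvgr0Pnorm_le => e e0.
have e1 : 0 < e / (`|C| + 1) by rewrite divr_gt0 ?ltr_wpDl.
have /cvgr0Pnorm_le/(_ _ e1) := a0; apply: filterS2 uC => x uC ae.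
rewrite normrM -[leRHS](divfK (x := `|C| + 1)) ?gt_eqF ?ltr_wpDl//.
apply: ler_pM => //; apply: le_trans uC _; apply: le_trans (ler_norm _) _.
by rewrite lerDl.
Qed.

Lemma near_eq_continuous (T U : topologicalType) (f g : T -> U) x :
  (\forall y \near x, f y = g y) -> {for x, continuous f} -> {for x, continuous g}.
Proof.
move=> fg; rewrite /prop_for /continuous_at (nbhs_singleton fg); apply: cvg_trans.
by apply: near_eq_cvg; apply: filterS fg => y ->.
Qed.

Lemma smooth_mxalgS (R : realType) (M : manifold R) n N (V W : set 'rV[R]_n)
    (Phi : Cinf M -> 'rV[R]_n -> 'M[R]_N) : W `<=` V ->
  smooth_mxalg V Phi -> smooth_mxalg W Phi.
Proof.
move=> WV [Pa Ps]; split=> [p /WV/Pa//|f i j].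
exact: smooth_onS (Ps f i j).
Qed.

Section FamilyExpansion.
Variables (R : realType) (M : manifold R) (n N : nat) (V : set 'rV[R]_n).
Hypothesis oV : open V.
Variable Phi : Cinf M -> 'rV[R]_n -> 'M[R]_N.
Hypothesis Phi_alg : smooth_mxalg V Phi.
Variable F : 'rV[R]_n -> M -> R.
Hypothesis FV : smooth_family V F.

Lemma family_expand p0 : V p0 -> exists (e : R) (Q : 'I_n -> 'rV[R]_n -> M -> R),
  [/\ 0 < e, ball p0 e `<=` V, forall i, smooth_family (ball p0 e) (Q i),
      forall p, ball p0 e p -> Phi (to_Cinf (F p)) p =
        Phi (to_Cinf (F p0)) p + \sum_i (p 0 i - p0 0 i) *: Phi (to_Cinf (Q i p)) p &
      forall i, Q i p0 = fun y => 'D_(delta_mx 0 i) (F^~ y) p0].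
Proof.
move=> Vp0; have [e e0 eV] : exists2 e : R, 0 < e & ball p0 e `<=` V.
  by apply/nbhs_ballP; exact: open_nbhs_nbhs.
have ob : open (ball p0 e) by exact: ball_open.
have bp0 : ball p0 e p0 by exact: ballxx.
have [Q [Qf QE QD]] := family_hadamard ob bp0 (fun p s => @ball_seg _ _ p0 p e s) (smooth_familyS eV FV).
exists e, Q; split=> // [p bp|i]; last by apply/funext => y; exact: QD.
have ca := Phi_alg.1 p (eV p bp).
rewrite (_ : to_Cinf (F p) = to_Cinf (F p0) + \sum_i (p 0 i - p0 0 i) *: to_Cinf (Q i p)).
  rewrite (mxalgD ca) (mxalg_sum ca); congr (_ + _); apply: eq_bigr => i _.
  by rewrite (mxalgZ ca).
apply: cinf_ext => y.
transitivity (to_Cinf (F p0) y + (\sum_i (p 0 i - p0 0 i) *: to_Cinf (Q i p) : Cinf M) y) => //.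
rewrite (@big_morph _ _ (fun f : Cinf M => f y) 0 +%R 0 +%R)//.
rewrite !to_CinfE; [|exact: family_slice oV FV Vp0|exact: family_slice oV FV (eV p bp)].
rewrite QE//; congr (_ + _); apply: eq_bigr => i _.
transitivity ((p 0 i - p0 0 i) * to_Cinf (Q i p) y) => //.
by rewrite to_CinfE//; exact: family_slice ob (Qf i) bp.
Qed.

Lemma family_continuous p0 i j : V p0 ->
  {for p0, continuous (fun p => Phi (to_Cinf (F p)) p i j)}.
Proof.
move=> Vp0; have [e [Q [e0 eV Qf QE _]]] := family_expand Vp0.
have bn : \forall p \near p0, ball p0 e p by exact: nbhsx_ballx.
have FF := nbhs_filter p0.
apply: (@near_eq_continuous _ _ (fun p => Phi (to_Cinf (F p0)) p i j +
    \sum_l (p 0 l - p0 0 l) * Phi (to_Cinf (Q l p)) p i j)).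
  apply: filterS bn => p bp; rewrite QE// mxE summxE; congr (_ + _).
  by apply: eq_bigr => l _; rewrite mxE.
apply: cvgD; first exact: (entry_continuous Phi_alg Vp0).
apply: (cvg_sum_fin FF) => l; rewrite subrr mul0r.
have [C QC] := family_locbdd (@ball_open _ _ p0 e) (smooth_mxalgS eV Phi_alg) (Qf l) (ballxx p0 e0).
apply: (@cvg_mul_bounded _ _ (nbhs p0) _ _ C).
  rewrite -[X in _ --> X](subrr (p0 0 l)); apply: cvgB; last exact: cvg_cst.
  exact: (@coord_continuous R 1 n 0 l p0).
by apply: filterS QC => p; apply.
Qed.

End FamilyExpansion.

Section FamilyDerivative.
Variables (R : realType) (M : manifold R) (n N : nat) (V : set 'rV[R]_n).
Hypothesis oV : open V.
Variable Phi : Cinf M -> 'rV[R]_n -> 'M[R]_N.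
Hypothesis Phi_alg : smooth_mxalg V Phi.

(** The part with F frozen at p0 is differentiable by the smoothness of Phi on a fixed function; the
    Hadamard remainder is a Carathéodory expansion, its coefficients being continuous by
    [family_continuous] applied to the quotients. *)
Lemma family_diff F p0 i j : smooth_family V F -> V p0 ->
  differentiable (fun p => Phi (to_Cinf (F p)) p i j) p0 /\
  forall l, 'D_(delta_mx 0 l) (fun p => Phi (to_Cinf (F p)) p i j) p0 =
    'D_(delta_mx 0 l) (fun p => Phi (to_Cinf (F p0)) p i j) p0 +
    Phi (to_Cinf (fun y => 'D_(delta_mx 0 l) (F^~ y) p0)) p0 i j.
Proof.
move=> FV Vp0; have [e [Q [e0 eV Qf QE QD]]] := family_expand oV Phi_alg FV Vp0.
have bn : \forall p \near p0, ball p0 e p by exact: nbhsx_ballx.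
pose G1 p := Phi (to_Cinf (F p0)) p i j.
pose G2 (p : 'rV[R]_n) := \sum_l (p 0 l - p0 0 l) * Phi (to_Cinf (Q l p)) p i j.
have GE : \forall p \near p0, (G1 + G2) p = Phi (to_Cinf (F p)) p i j.
  apply: filterS bn => p bp; rewrite QE// mxE summxE; congr (_ + _).
  by apply: eq_bigr => l _; rewrite mxE.
have d1 : differentiable G1 p0 by have [+ _] := Phi_alg.2 (to_Cinf (F p0)) i j 1; exact.
have [|l|d2 D2] := @caratheodory_diff _ _ G2 (fun l p => Phi (to_Cinf (Q l p)) p i j) p0.
- near=> p; rewrite {2}/G2 big1 ?add0r// => l _.
  by rewrite subrr mul0r.
- have := @family_continuous _ _ _ _ (ball p0 e) (@ball_open _ _ p0 e) Phi
    (smooth_mxalgS eV Phi_alg) (Q l) (Qf l) p0 i j (ballxx p0 e0).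
  by [].
split.
  by apply: differentiable_near GE _; exact: differentiableD.
move=> l; rewrite -(near_eq_derive _ GE) deriveD; [|exact: diff_derivable..].
by rewrite D2 QD.
Unshelve. all: by end_near.
Qed.


(** The homomorphism Phi + eps dPhi over the dual numbers, with eps realised as a nilpotent block so
    that the values are again real matrices. *)
Definition prolong (l : 'I_n) (f : Cinf M) (p : 'rV[R]_n) : 'M[R]_(N + N) :=
  block_mx (Phi f p) (\matrix_(i, j) 'D_(delta_mx 0 l) (fun p => Phi f p i j) p)
           0 (Phi f p).

(* The Leibniz rule is what makes [prolong] multiplicative. *)
Lemma prolong_alg l : smooth_mxalg V (prolong l).
Proof.
have dP f i j p : V p -> differentiable (fun p => Phi f p i j) p.
  by move=> Vp; have [+ _] := Phi_alg.2 f i j 1; exact.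
have derP f i j p v : V p -> derivable (fun p => Phi f p i j) p v.
  by move=> Vp; apply: diff_derivable; exact: dP.
have near_derive (f g : 'rV[R]_n -> R) p v : V p -> (forall q, V q -> f q = g q) ->
    'D_v f p = 'D_v g p.
  move=> Vp fg; apply: near_eq_derive.
  by apply: filterS (open_nbhs_nbhs (conj oV Vp)) => q /fg.
split=> [p Vp|f i j].
  have ca := Phi_alg.1 p Vp; split=> [f g|f g||a f]; rewrite /prolong.
  - rewrite (mxalgD ca) add_block_mx addr0; congr block_mx.
    apply/matrixP => i j; rewrite !mxE -deriveD; [|exact: derP..].
    by apply: near_derive => // q Vq; rewrite (mxalgD (Phi_alg.1 q Vq)) mxE.
  - rewrite (mxalgM ca) mulmx_block !mulmx0 !mul0mx addr0 !add0r; congr block_mx.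
    apply/matrixP => i j; rewrite !mxE -big_split/=.
    rewrite (@near_derive _ (\sum_(k < N) ((fun q => Phi f q i k) * (fun q => Phi g q k j)))) //; last first.
      by move=> q Vq; rewrite (mxalgM (Phi_alg.1 q Vq)) mxE fct_sumE.
    rewrite derive_sum => [|k]; last by apply: derivableM; exact: derP.
    apply: eq_bigr => k _; rewrite deriveM; [|exact: derP..].
    by rewrite !mxE; congr (_ + _); exact: mulrC.
  - rewrite (mxalg1 ca) [RHS]scalar_mx_block; congr block_mx.
    apply/matrixP => i j; rewrite !mxE -[RHS](derive_cst (1%:M i j : R) p (delta_mx 0 l)).
    by apply: near_derive => // q Vq; rewrite (mxalg1 (Phi_alg.1 q Vq)).
  - rewrite (mxalgZ ca) scale_block_mx scaler0; congr block_mx.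
    apply/matrixP => i j; rewrite !mxE.
    have -> : a * 'D_(delta_mx 0 l) (fun q => Phi f q i j) p =
        a *: 'D_(delta_mx 0 l) (fun q => Phi f q i j) p by [].
    rewrite -deriveZ; last exact: derP.
    by apply: near_derive => // q Vq; rewrite (mxalgZ (Phi_alg.1 q Vq)) mxE.
rewrite -(splitK i) -(splitK j).
case: (fintype.split i) => i'; case: (fintype.split j) => j' /=.
- apply: smooth_on_ext (Phi_alg.2 f i' j') => // p _.
  by rewrite /prolong block_mxEul.
- apply: smooth_on_ext (smooth_on_derive l (Phi_alg.2 f i' j')) => // p _.
  by rewrite /prolong block_mxEur mxE.
- apply: smooth_on_ext (smooth_on_cst V 0) => // p _.
  by rewrite /prolong block_mxEdl mxE.
- apply: smooth_on_ext (Phi_alg.2 f i' j') => // p _.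
  by rewrite /prolong block_mxEdr.
Qed.

End FamilyDerivative.

Lemma family_smooth (R : realType) (M : manifold R) n N (V : set 'rV[R]_n)
    (Phi : Cinf M -> 'rV[R]_n -> 'M[R]_N) F i j : open V ->
  smooth_mxalg V Phi -> smooth_family V F -> smooth_on V (fun p => Phi (to_Cinf (F p)) p i j).
Proof.
move=> oV Pa FV k; elim: k N Phi F i j Pa FV => [//|k IHk] N Phi F i j Pa FV.
split=> [p Vp|l]; first by have [] := family_diff oV Pa i j FV Vp.
(* The upper right block of [prolong], taken on F p at p, is the derivative with F p frozen, the
   first term of [family_diff]. The size of the matrices doubles here, hence the generality in N. *)
have h1 := IHk _ _ _ (lshift N i) (rshift N j) (prolong_alg oV Pa l) FV.
have h2 := IHk _ _ _ i j Pa (family_derive l oV FV).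
apply: ndiff_on_ext (ndiff_onD oV h1 h2) => // p Vp.
have [_ ->] := family_diff oV Pa i j FV Vp.
by rewrite fctE /prolong block_mxEur mxE.
Qed.

(** * Extension to the product *)

Section RealForm.
Variables (R : realType) (r : nat).
Local Notation C := R[i].

(** The action of A on C^r seen as R^r + i R^r. It turns sections of End(E) into families of real
    matrices, and the left blocks give back the real and imaginary parts. *)
Definition realmx (A : 'M[C]_r) : 'M[R]_(r + r) :=
  block_mx (map_mx (@complex.Re R) A) (- map_mx (@complex.Im R) A)
           (map_mx (@complex.Im R) A) (map_mx (@complex.Re R) A).

Lemma realmxD A B : realmx (A + B) = realmx A + realmx B.
Proof.
rewrite /realmx add_block_mx; congr block_mx; apply/matrixP => i j; rewrite !mxE;
  by case: (A i j) (B i j) => ? ? [? ?] //=; rewrite opprD.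
Qed.

Lemma Re_sum n (u : 'I_n -> C) : complex.Re (\sum_k u k) = \sum_k complex.Re (u k).
Proof. by apply: (big_morph (@complex.Re R)) => // -[? ?] []. Qed.

Lemma Im_sum n (u : 'I_n -> C) : complex.Im (\sum_k u k) = \sum_k complex.Im (u k).
Proof. by apply: (big_morph (@complex.Im R)) => // -[? ?] []. Qed.

Lemma realmxM A B : realmx (A *m B) = realmx A *m realmx B.
Proof.
have re : map_mx (@complex.Re R) (A *m B) = map_mx (@complex.Re R) A *m map_mx (@complex.Re R) B
    - map_mx (@complex.Im R) A *m map_mx (@complex.Im R) B.
  apply/matrixP => i j; rewrite !mxE Re_sum -sumrB; apply: eq_bigr => k _.
  by rewrite !mxE; case: (A i k) (B k j) => ? ? [? ?].
have im : map_mx (@complex.Im R) (A *m B) = map_mx (@complex.Re R) A *m map_mx (@complex.Im R) B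
    + map_mx (@complex.Im R) A *m map_mx (@complex.Re R) B.
  apply/matrixP => i j; rewrite !mxE Im_sum -big_split; apply: eq_bigr => k _.
  by rewrite !mxE; case: (A i k) (B k j) => ? ? [? ?].
rewrite /realmx mulmx_block re im !mulmxN !mulNmx; congr block_mx.
- by rewrite opprD.
- by rewrite addrC.
- by rewrite addrC.
Qed.

Lemma realmx1 : realmx 1%:M = 1%:M.
Proof.
rewrite /realmx [RHS]scalar_mx_block; congr block_mx; apply/matrixP => i j; rewrite !mxE;
  by case: (i == j); rewrite //= oppr0.
Qed.

Lemma realmxZ (a : R) A : realmx (a%:C%C *: A) = a *: realmx A.
Proof.
rewrite /realmx scale_block_mx; congr block_mx; apply/matrixP => i j; rewrite !mxE;
  case: (A i j) => x y //=; rewrite ?mul0r ?subr0 ?addr0 //.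
by rewrite mulrN.
Qed.

End RealForm.

Section Extension.
Variables (R : realType) (X : premanifold R) (Y : manifold R) (r : nat).
Variables (E : cvbundle X r) (phi : Cinf Y -> endsec E).
Hypothesis phi_hom : ring_hom_over phi.
Local Notation XY := (prod_premanifold X Y).

Lemma prod_family (F : Cinf XY) (c : chart R X (pdim X)) : patlas c ->
  smooth_family (M := Y) (cmap c @` cdom c) (fun p y => F (cinv c p, y)).
Proof.
move=> Ac d Ad.
have Acd : @patlas R XY (prod_chart c d) by exists c => //; exists d.
by have := cfunP F Acd; rewrite setIT /= prod_imgE.
Qed.

Lemma slice_smooth (F : Cinf XY) x : (fun y => F (x, y)) \in msmooth_pred (M := Y).
Proof.
apply/asboolP; have [c Ac cx] := patlas_cover x.
have cix : (cmap c @` cdom c) (cmap c x) by exists x.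
have := family_slice (@cimg_open _ _ _ c) (prod_family F Ac) cix.
by rewrite cmapK ?inE.
Qed.

Definition slice (F : Cinf XY) x : Cinf Y := MkCinf (slice_smooth F x).

Lemma to_Cinf_slice (F : Cinf XY) x : to_Cinf (fun y => F (x, y)) = slice F x.
Proof. by apply: cinf_ext => y; rewrite to_CinfE//; exact: cfunP (slice F x). Qed.

Section Trivialisation.
Variables (b : bundle_chart r E) (c : chart R X (pdim X)).
Hypotheses (Ab : batlas b) (Ac : patlas c).

Definition local_hom (f : Cinf Y) (p : 'rV[R]_(pdim X)) : 'M[R]_(r + r) :=
  realmx (endmx b (phi f (cinv c p))).

Lemma local_hom_alg : smooth_mxalg (cmap c @` (cdom c `&` bdom b)) local_hom.
Proof.
have [phiB [phi1 phiM] phiZ] := phi_hom.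
have phiD f g : phi (f + g) = phi f + phi g.
  have phi0 : phi 0 = 0 by rewrite -(subrr 0) phiB subrr.
  by rewrite -{1}(opprK g) phiB -[- g]sub0r phiB phi0 sub0r opprK.
split=> [_ [x [cx bx] <-]|f i j].
  rewrite /local_hom /=; split=> [f g|f g||a f]; rewrite cmapK ?inE//.
  - by rewrite phiD endmxD realmxD.
  - by rewrite phiM /= endmxM// realmxM.
  - by rewrite phi1 /= endmx1// realmx1.
  - by rewrite phiZ /= endmxZ realmxZ.
have oV : open (cmap c @` (cdom c `&` bdom b)) by apply: cimg_openI; exact: bdom_open.
have reS i' j' := (esecP (phi f) Ab i' j').1 c Ac.
have imS i' j' := (esecP (phi f) Ab i' j').2 c Ac.
rewrite -(splitK i) -(splitK j).
case: (fintype.split i) => i'; case: (fintype.split j) => j' /=.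
- apply: smooth_on_ext (reS i' j') => // p _.
  by rewrite /local_hom /realmx block_mxEul mxE.
- apply: smooth_on_ext (smooth_on_opp oV (imS i' j')) => // p _.
  by rewrite /local_hom /realmx block_mxEur [RHS]mxE [in RHS]mxE.
- apply: smooth_on_ext (imS i' j') => // p _.
  by rewrite /local_hom /realmx block_mxEdl mxE.
- apply: smooth_on_ext (reS i' j') => // p _.
  by rewrite /local_hom /realmx block_mxEdr mxE.
Qed.

Lemma local_hom_slice_smooth (F : Cinf XY) i j :
  smooth_on (cmap c @` (cdom c `&` bdom b))
    (fun p => local_hom (slice F (cinv c p)) p i j).
Proof.
have oV : open (cmap c @` (cdom c `&` bdom b)) by apply: cimg_openI; exact: bdom_open.
have FV : smooth_family (M := Y) (cmap c @` (cdom c `&` bdom b)) (fun p y => F (cinv c p, y)).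
  by apply: smooth_familyS (prod_family F Ac) => _ [x [cx _] <-]; exists x.
apply: smooth_on_ext (family_smooth i j oV local_hom_alg FV) => // p _.
by rewrite to_Cinf_slice.
Qed.

End Trivialisation.

Lemma extension_end_smooth (F : Cinf XY) : end_smooth (fun x => phi (slice F x) x).
Proof.
move=> b Ab i j; split=> c Ac.
- have H := local_hom_slice_smooth Ab Ac F (lshift r i) (lshift r j).
  apply: smooth_on_ext H; first by apply: cimg_openI; exact: bdom_open.
  by move=> p _; rewrite /local_hom /realmx block_mxEul mxE.
- have H := local_hom_slice_smooth Ab Ac F (rshift r i) (lshift r j).
  apply: smooth_on_ext H; first by apply: cimg_openI; exact: bdom_open.
  by move=> p _; rewrite /local_hom /realmx block_mxEdl mxE.
Qed.

Definition extension (F : Cinf XY) : endsec E := EndSec (extension_end_smooth F).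

(** For fixed x, slicing at x respects the operations, so each law is that of [phi] evaluated at
    x. *)
Lemma extension_hom : ring_hom_over extension.
Proof.
have [phiB [phi1 phiM] phiZ] := phi_hom; split.
- move=> F G; apply: endsec_ext => x.
  transitivity (phi (slice F x - slice G x) x); last by rewrite phiB.
  by congr (esec (phi _) x); exact: cinf_ext.
- split=> [|F G]; apply: endsec_ext => x.
    transitivity (phi 1 x); last by rewrite phi1.
    by congr (esec (phi _) x); exact: cinf_ext.
  transitivity (phi (slice F x * slice G x) x); last by rewrite phiM.
  by congr (esec (phi _) x); exact: cinf_ext.
- move=> a F; apply: endsec_ext => x.
  transitivity (phi (a *: slice F x) x); last by rewrite phiZ.
  by congr (esec (phi _) x); exact: cinf_ext.
Qed.

Lemma extension_pr2 f : extension (pr2_pullback X f) = phi f.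
Proof.
by apply: endsec_ext => x; congr (esec (phi _) x); exact: cinf_ext.
Qed.

(** The slice at x of a function pulled back from X is the constant f x, which compatibility with
    real scalars sends to f x times the identity. *)
Lemma extension_pr1 f : extension (pr1_pullback Y f) = scalar_sec E f.
Proof.
have [_ [phi1 _] phiZ] := phi_hom.
apply: endsec_ext => x; transitivity (phi (f x *: (1 : Cinf Y)) x).
  by congr (esec (phi _) x); apply: cinf_ext => y; apply/esym; exact: mulr1.
by rewrite phiZ phi1.
Qed.

Lemma ring_hom_over_Cinf_admissible : Cinf_admissible phi.
Proof.
exists extension; split; [exact: extension_hom|exact: extension_pr2|exact: extension_pr1|].
have [S [Sc Sh SN]] := range_cinf_ring extension_hom.
have h1 : cinf_hom (Cinf_ring X) (Cinf_ring XY) (@pr1_pullback R X Y).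
  by move=> n h a; apply: cinf_ext.
have h2 : cinf_hom (Cinf_ring Y) (Cinf_ring XY) (@pr2_pullback R X Y).
  by move=> n h a; apply: cinf_ext.
exists S; split=> //.
- have := SN _ _ h2; rewrite (_ : extension \o _ = phi)//.
  by apply/funext => f; exact: extension_pr2.
- have := SN _ _ h1; rewrite (_ : extension \o _ = scalar_sec E)//.
  by apply/funext => f; exact: extension_pr1.
Qed.

End Extension.

Theorem theorem3p1p1 (R : realType) (X Y : manifold R) (r : nat)
    (E : cvbundle X r) (phi : Cinf Y -> endsec E) :
  (ring_hom_over phi <->
     ring_hom_over phi /\ weakly_Cinf_admissible phi) /\
  (ring_hom_over phi /\ weakly_Cinf_admissible phi <->
     ring_hom_over phi /\ Cinf_admissible phi).
Proof.
have weak : ring_hom_over phi -> weakly_Cinf_admissible phi.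
  by move=> /range_cinf_ring[S [Sc Sh _]]; exists S.
split.
  by split=> [h|[]//]; split=> //; exact: weak.
split=> -[h _]; split=> //; first exact: ring_hom_over_Cinf_admissible.
exact: weak.
Qed.
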